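(* Let $L$ be a Markov generator on $L^2(\mu)$, where $\mu$ is an invariant probability measure on a measurable space $S$. Suppose that $L$ has compact resolvent, and that the kernel of $L$ consists only of constants. Then $L$ has a positive singular-value gap on $L^2_0(\mu)$: $$\gamma:=\inf_{f\in\operatorname{Dom}(L)\cap L^2_0(\mu)\setminus\{0\}}\frac{\|Lf\|}{\|f\|}>0.$$ Consequently, for every $t>0$, $$\Delta_t\le\frac{2}{\sqrt{\gamma t}}\qquad\text{and}\qquad \sup_{s\in[t,2t]}\Delta_s\ge\frac{1}{\frac32\gamma t+3}.$$
   Context: $L$ is the generator of the strongly continuous semigroup $P_tg(x)=\mathbb E_x[g(X_t)]$ on $L^2(\mu)$ of a time-homogeneous Markov process $(X_t)_{t\ge0}$ on $S$ with jointly measurable sample paths: $Lg=\lim_{t\downarrow0}(P_tg-g)/t$, with $\operatorname{Dom}(L)$ the set of $g\in L^2(\mu)$ for which the limit exists in $L^2(\mu)$. $L^2(\mu)$ is the space of complex-valued square-integrable functions with norm $\|\cdot\|$; $L^2_0(\mu)=\{g\in L^2(\mu):\int g\,d\mu=0\}$. Compact resolvent is equivalent to compactness of the embedding of $(\operatorname{Dom}(L),\|\cdot\|+\|L\cdot\|)$ into $L^2(\mu)$. $\mathbb E_\mu$ denotes expectation with $X_0\sim\mu$, $\mu g=\int g\,d\mu$, $\mu_tg=\frac1t\int_0^tg(X_s)\,ds$, $\operatorname{Var}_\mu(\mu_tg)=\mathbb E_\mu|\mu_tg-\mu g|^2$, and $\Delta_t:=\sup_{g\in L^2_0(\mu),\,\|g\|=1}\sqrt{\operatorname{Var}_\mu(\mu_tg)}$.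 Conventions: $\inf\emptyset=+\infty$, $\sup\emptyset=0$, $1/\infty=0$. *)

(* Defs.v *)
From HB Require Import structures.
From mathcomp Require Import all_boot all_order all_algebra.
From mathcomp Require Import complex.
From mathcomp Require Import all_classical all_reals all_analysis.

Set Implicit Arguments.
Unset Strict Implicit.
Unset Printing Implicit Defensive.

Import Order.TTheory GRing.Theory Num.Theory.
Import numFieldNormedType.Exports.

Local Open Scope classical_set_scope.
Local Open Scope ring_scope.

(* Elements of the complex space L^2(mu) are represented by measurable
   square-integrable functions f : S -> R[i].  When mu is invariant, every notion
   below is insensitive to modifying these functions on mu-null sets; equality
   in L^2(mu) is written f = g %[ae mu]. *)

Section ComplexL2.
Context d (S : measurableType d) (R : realType).

Definition cmeasurable (f : S -> R[i]) : Prop :=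
  measurable_fun [set: S] (fun x => complex.Re (f x)) /\
  measurable_fun [set: S] (fun x => complex.Im (f x)).

Definition cintegral (m : {measure set S -> \bar R}) (D : set S)
    (f : S -> R[i]) : R[i] :=
  Complex (\int[m]_(x in D) complex.Re (f x))
          (\int[m]_(x in D) complex.Im (f x)).

Variable mu : {measure set S -> \bar R}.

Definition L2norm (f : S -> R[i]) : \bar R :=
  ('N[mu]_2%:E[(fun x => (Normc.normc (f x))%:E)])%E.

Definition L2 (f : S -> R[i]) : Prop :=
  cmeasurable f /\ (L2norm f < +oo)%E.

Definition L20 (f : S -> R[i]) : Prop :=
  L2 f /\ cintegral mu setT f = 0.

End ComplexL2.

Section PathLaw.
Context d d' (S : measurableType d) (Om : measurableType d') (R : realType).
Variables (PP : R.-pker S ~> Om) (mu : probability S R).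

(* P_mu, the law under which X_0 has distribution mu, when PP x is the law of
   the process started at x. *)
Definition path_law (A : set Om) : \bar R := (\int[mu]_x PP x A)%E.

Let path_law0 : path_law set0 = 0%E.
Proof.
by rewrite /path_law; under eq_integral do rewrite measure0; rewrite integral0.
Qed.

Let path_law_ge0 A : (0 <= path_law A)%E.
Proof. by apply: integral_ge0 => x _; exact: measure_ge0. Qed.

Let path_law_sigma_additive : semi_sigma_additive path_law.
Proof.
move=> F mF tF mUF.
rewrite [X in _ --> X](_ : _ = \int[mu]_x (\sum_(n <oo) PP x (F n)))%E; last first.
  apply: eq_integral => x _.
  by apply/esym/cvg_lim => //; exact: measure_semi_sigma_additive.
rewrite integral_nneseries//; last by move=> n; exact: measurable_kernel.
by apply: is_cvg_nneseries => n _ _; exact: path_law_ge0.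
Qed.

HB.instance Definition _ := isMeasure.Build _ _ _ path_law
  path_law0 path_law_ge0 path_law_sigma_additive.

Let path_lawT : path_law setT = 1%E.
Proof.
rewrite /path_law; under eq_integral do rewrite prob_kernel.
by rewrite integral_cst// mul1e; exact: probability_setT.
Qed.

HB.instance Definition _ :=
  Measure_isProbability.Build _ _ _ path_law path_lawT.

End PathLaw.

Section MarkovProcess.
Context d d' (S : measurableType d) (Om : measurableType d') (R : realType).
Variables (PP : R.-pker S ~> Om) (X : R -> Om -> S).

(* Events of the natural filtration F_t = sigma(X_u, 0 <= u <= t). *)
Definition past (t : R) : set (set Om) :=
  <<s [set B | exists u (A : set S),
         [/\ 0 <= u, u <= t, measurable A & B = X u @^-1` A]] >>.

(* (X_t)_{t >= 0} with the laws PP x of the process started at x; the values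
   of X at negative times are irrelevant.  [markov_start] says X_0 = x almost
   surely under PP x, without requiring {x} to be measurable;
   [markov_property] is
   P_x(X_{t+s} \in A | F_t) = P_{X_t}(X_s \in A), integrated over F \in F_t. *)
Record is_markov_process : Prop := {
  markov_path_measurable :
    measurable_fun [set u : measurableTypeR R * Om | 0 <= u.1]
                   (fun u => X u.1 u.2) ;
  markov_start : forall x (A : set S), measurable A ->
    PP x (X 0 @^-1` A) = \d_x A ;
  markov_property : forall x (s t : R) (F : set Om) (A : set S),
    0 <= s -> 0 <= t -> past t F -> measurable A ->
    PP x (F `&` X (t + s) @^-1` A)
    = (\int[PP x]_(w in F) PP (X t w) (X s @^-1` A))%E }.

Definition is_invariant (mu : probability S R) : Prop :=
  forall (t : R) (A : set S), 0 <= t -> measurable A ->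
    (\int[mu]_x PP x (X t @^-1` A))%E = mu A.

Definition semigroup (t : R) (g : S -> R[i]) : S -> R[i] :=
  fun x => cintegral (PP x) setT (fun w => g (X t w)).

Variable mu : probability S R.

Definition strongly_continuous : Prop :=
  forall g, L2 mu g ->
    L2norm mu (fun x => semigroup t g x - g x) @[t --> 0^'+] --> 0%E.

(* Graph of L: f \in Dom(L) and L f = h in L^2(mu). *)
Definition generator (f h : S -> R[i]) : Prop :=
  [/\ L2 mu f, L2 mu h &
    L2norm mu (fun x => (t^-1)%:C%C * (semigroup t f x - f x) - h x)
      @[t --> 0^'+] --> 0%E].

(* Graph of the resolvent: f \in Dom(L) and (lambda - L) f = g. *)
Definition resolvent (lambda : R[i]) (g f : S -> R[i]) : Prop :=
  exists h, generator f h /\ (fun x => lambda * f x - h x) = g %[ae mu].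

Definition in_resolvent_set (lambda : R[i]) : Prop :=
  [/\ forall g, L2 mu g -> exists f, resolvent lambda g f,
      forall g f1 f2, resolvent lambda g f1 -> resolvent lambda g f2 ->
        f1 = f2 %[ae mu] &
      exists C : R, forall g f, L2 mu g -> resolvent lambda g f ->
        (L2norm mu f <= C%:E * L2norm mu g)%E].

(* The resolvent at lambda maps bounded sequences to sequences having an
   L^2-convergent subsequence. *)
Definition resolvent_compact_at (lambda : R[i]) : Prop :=
  forall (g f : nat -> S -> R[i]) (M : R),
    (forall n, L2 mu (g n) /\ (L2norm mu (g n) <= M%:E)%E) ->
    (forall n, resolvent lambda (g n) (f n)) ->
    exists (k : nat -> nat) (l : S -> R[i]),
      [/\ {homo k : m n / (m < n)%N}, L2 mu l &
        L2norm mu (fun x => f (k n) x - l x) @[n --> \oo] --> 0%E].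

Definition compact_resolvent : Prop :=
  exists lambda, in_resolvent_set lambda /\ resolvent_compact_at lambda.

Definition kernel_only_constants : Prop :=
  forall f, generator f (cst 0) -> exists c : R[i], f = cst c %[ae mu].

Definition singular_value_gap : \bar R :=
  ereal_inf [set r | exists f h, [/\ generator f h, L20 mu f,
    ~ (f = cst 0 %[ae mu]) & r = (L2norm mu h / L2norm mu f)%E]].

Definition time_average (t : R) (g : S -> R[i]) (w : Om) : R[i] :=
  (t^-1)%:C%C *
  cintegral (@lebesgue_measure R) `[0, t] (fun s => g (X s w)).

Definition Var_time_average (t : R) (g : S -> R[i]) : \bar R :=
  'E_(path_law PP mu)[fun w => Normc.normc
                (time_average t g w - cintegral mu setT g) ^+ 2].

(* 0 is adjoined because the supremum over the empty set is 0 by convention;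
   all the other elements are nonnegative. *)
Definition Delta (t : R) : \bar R :=
  ereal_sup (0%E |` [set r | exists g, [/\ L20 mu g, L2norm mu g = 1%E &
                       r = sqrte (Var_time_average t g)]]).

End MarkovProcess.

(* Main.v *)
From HB Require Import structures.
Require Import Defs.
From mathcomp Require Import all_boot all_order all_algebra.
From mathcomp Require Import complex.
From mathcomp Require Import all_classical all_reals all_analysis.
From mathcomp Require Import measurable_realfun.
From mathcomp Require Import ring lra.
Import Order.TTheory GRing.Theory Num.Theory.
Import numFieldNormedType.Exports.
Local Open Scope classical_set_scope.
Local Open Scope ring_scope.

(** The semigroup P_t is given by a real kernel, so it acts separately on real
and imaginary parts and it suffices to work in the real Hilbert space
L^2(mu), with inner product <u, v> and norm |u|.

The object behind both bounds is G_s u = \int_0^s P_r u dr.  The semigroup law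
gives P_h G_s u - G_s u = P_s G_h u - G_h u; dividing by h and letting h tend
to 0, strong continuity shows that G_s u is in the domain of the generator and
that L (G_s u) = P_s u - u [real_generator_Pt_int].  If f is in Dom(L) then
also P_s f - f = G_s (L f) [dynkin_formula].

Positivity of the gap.  If gamma were 0, there would be unit vectors f_n of
mean zero in Dom(L) with L f_n -> 0.  Then g_n = lambda f_n - L f_n is bounded
and f_n is the resolvent of g_n, so a subsequence converges, to l say.
Continuity of the resolvent at lambda l identifies l with an element of Dom(L)
with L l = 0; hence l is constant, of mean zero and of norm 1, which is absurd
[singular_value_gap_gt0].

Upper bound.  For u of mean zero, applying the definition of gamma to G_s u
gives gamma |G_s u| <= |P_s u - u| <= 2 |u|  [gap_Pt_int].  By the Markov
property and stationarity, the correlation of Y_t = \int_0^t u(X_r) dr with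
u(X_s) is <u, G_s u> + <u, G_(t-s) u>, one term for the past of s and one for
its future.  Integrating over s in [0, t] gives
E Y_t^2 <= 4 t |u|^2 / gamma [nrm_path_int_le, Delta_le].

Lower bound.  As G_s w is the conditional expectation of the path integral Y_s
given X_0, |G_s w| <= s Delta_s |w| for w of mean zero.  Let D be the supremum
of Delta over [t, 2t] and f in Dom(L) of mean zero.  In
  t f = (G_2t f - G_t f) - \int_t^2t (P_s f - f) ds
the bracket has norm at most 3 t D |f|, and P_s f - f = G_s (L f) has norm at
most s D |L f|, so that |f| <= D (3 |f| + (3/2) t |L f|) [nrm_le_Delta]; the
infimum over f gives the claim [Delta_ge].

Time integrals of functions in L^2 are pointwise Lebesgue integrals.  They are
handled weakly: for K = \int k_s ds, Fubini gives <z, K> = \int <z, k_s> ds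
[ip_param_int], and identities in L^2(mu) are checked against all z. *)

Set Implicit Arguments.
Unset Strict Implicit.
Unset Printing Implicit Defensive.

(** * Real square-integrable functions *)

(** Locked, as are [Pt] and [Pt_int] below: comparing two different inner
products up to conversion would unfold the Lebesgue integral. *)
HB.lock Definition ip d (T : measurableType d) (R : realType)
  (m : {measure set T -> \bar R}) (f g : T -> R) : R := \int[m]_x (f x * g x).

Section RealL2.
Context d (T : measurableType d) (R : realType).
Variable m : {measure set T -> \bar R}.
Implicit Types f g h z : T -> R.

Definition sqint f : Prop :=
  measurable_fun setT f /\ m.-integrable setT (fun x => (f x ^+ 2)%:E).

Definition nrm f : R := Num.sqrt (ip m f f).

Lemma sqint_meas f : sqint f -> measurable_fun setT f.
Proof. by case. Qed.

Lemma sqintP f : measurable_fun setT f ->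
  (\int[m]_x (f x ^+ 2)%:E < +oo)%E -> sqint f.
Proof.
move=> mf foo; split=> //; apply/integrableP; split.
  by apply/measurable_EFinP; exact: measurable_funX.
by under eq_integral do rewrite gee0_abs ?lee_fin ?sqr_ge0//.
Qed.

Lemma sqint_lty f : sqint f -> (\int[m]_x (f x ^+ 2)%:E < +oo)%E.
Proof.
move=> [_ /integrableP[_]].
by under eq_integral do rewrite gee0_abs ?lee_fin ?sqr_ge0//.
Qed.

Lemma sqint_mul f g : sqint f -> sqint g ->
  m.-integrable setT (fun x => (f x * g x)%:E).
Proof.
move=> [mf sf] [mg sg].
apply: (le_integrable _ _ _ (integrableD measurableT sf sg)) => //.
  by apply/measurable_EFinP; exact: measurable_funM.
move=> x _ /=; rewrite lee_fin [leRHS]ger0_norm ?addr_ge0 ?sqr_ge0//.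
rewrite normrM -(real_normK (num_real (f x))) -(real_normK (num_real (g x))).
have := normr_ge0 (f x); have := normr_ge0 (g x).
set a := `|f x|; set b := `|g x|; nra.
Qed.

Lemma sqintZ c f : sqint f -> sqint (fun x => c * f x).
Proof.
move=> [mf sf]; split; first exact: measurable_funM.
under [X in m.-integrable _ X]eq_fun do rewrite exprMn EFinM.
exact: integrableZl.
Qed.

Lemma sqintD f g : sqint f -> sqint g -> sqint (fun x => f x + g x).
Proof.
move=> sf sg; split; first by apply: measurable_funD; [case: sf|case: sg].
have fg := sqint_mul sf sg.
have := integrableD measurableT (integrableD measurableT sf.2 sg.2)
  (integrableD measurableT fg fg).
apply: eq_integrable => // x _ /=.
by rewrite -!EFinD; congr EFin; ring.
Qed.

Lemma sqintB f g : sqint f -> sqint g -> sqint (fun x => f x - g x).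
Proof.
move=> sf sg; have := sqintD sf (sqintZ (-1) sg).
by congr sqint; apply/funext => x; rewrite mulN1r.
Qed.

Lemma ipC f g : ip m f g = ip m g f.
Proof. by rewrite ip.unlock; under eq_Rintegral do rewrite mulrC. Qed.

Lemma ipDr f g h : sqint f -> sqint g -> sqint h ->
  ip m f (fun x => g x + h x) = ip m f g + ip m f h.
Proof.
move=> sf sg sh; rewrite ip.unlock; under eq_Rintegral do rewrite mulrDr.
by rewrite RintegralD//; exact: sqint_mul.
Qed.

Lemma ipZr c f g : sqint f -> sqint g ->
  ip m f (fun x => c * g x) = c * ip m f g.
Proof.
move=> sf sg; rewrite ip.unlock; under eq_Rintegral do rewrite mulrCA.
by rewrite RintegralZl//; exact: sqint_mul.
Qed.

Lemma ipBr f g h : sqint f -> sqint g -> sqint h ->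
  ip m f (fun x => g x - h x) = ip m f g - ip m f h.
Proof.
move=> sf sg sh; rewrite ip.unlock; under eq_Rintegral do rewrite mulrBr.
by rewrite RintegralB//; exact: sqint_mul.
Qed.

Lemma ip_ge0 f : 0 <= ip m f f.
Proof. by rewrite ip.unlock; apply: Rintegral_ge0 => x _; rewrite -expr2 sqr_ge0. Qed.

Lemma nrm_ge0 f : 0 <= nrm f.
Proof. exact: sqrtr_ge0. Qed.

Lemma nrm2 f : nrm f ^+ 2 = ip m f f.
Proof. by rewrite sqr_sqrtr// ip_ge0. Qed.

Lemma nrm2E f : sqint f -> (nrm f ^+ 2)%:E = (\int[m]_x (f x ^+ 2)%:E)%E.
Proof.
move=> sf; rewrite nrm2 ip.unlock /Rintegral.
under eq_integral do rewrite -expr2.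
by rewrite fineK// integrable_fin_num//; case: sf.
Qed.

Lemma nrmZ c f : sqint f -> nrm (fun x => c * f x) = `|c| * nrm f.
Proof.
move=> sf; rewrite /nrm ipZr ?(ipC _ f) ?ipZr//; last exact: sqintZ.
by rewrite mulrA -expr2 sqrtrM ?sqr_ge0// sqrtr_sqr.
Qed.

Lemma ipBB f g : sqint f -> sqint g ->
  ip m (fun x => f x - g x) (fun x => f x - g x)
  = ip m f f - 2 * ip m f g + ip m g g.
Proof.
move=> sf sg; rewrite ipBr//; last exact: sqintB.
by rewrite !(ipC (fun x => _ - _)) !ipBr// (ipC g f); ring.
Qed.

(** The nonnegativity of <af - bg, af - bg> for a = |g|, b = |f| or a = -|g|;
when a norm vanishes, the same inequality bounds all multiples of <f, g>. *)
Lemma cauchy_schwarz f g : sqint f -> sqint g -> `|ip m f g| <= nrm f * nrm g.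
Proof.
move=> sf sg.
have key a b : 2 * (a * b * ip m f g) <= a ^+ 2 * ip m f f + b ^+ 2 * ip m g g.
  have sa := sqintZ a sf; have sb := sqintZ b sg.
  have := ip_ge0 (fun x => a * f x - b * g x); rewrite ipBB// -!nrm2 !nrmZ//.
  rewrite ipZr// (ipC _ g) ipZr// (ipC g) !exprMn !real_normK ?num_real//.
  lra.
have lin (c M : R) : (forall a, a * c <= M) -> c = 0.
  move=> h; apply/eqP; apply/negPn/negP => c0.
  by have := h ((M + 1) / c); rewrite divfK// gerDl ler10.
have [f0|f0] := eqVneq (nrm f) 0.
  suff -> : ip m f g = 0 by rewrite f0 normr0 mul0r.
  apply: (lin _ (ip m g g)) => a; have := key a 1.
  by rewrite -(nrm2 f) f0 expr0n/=; have := ip_ge0 g; lra.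
have [g0|g0] := eqVneq (nrm g) 0.
  suff -> : ip m f g = 0 by rewrite g0 normr0 mulr0.
  apply: (lin _ (ip m f f)) => a; have := key 1 a.
  by rewrite -(nrm2 g) g0 expr0n/=; have := ip_ge0 f; lra.
have fgp : 0 < nrm f * nrm g by rewrite mulr_gt0// lt_def ?f0 ?g0 nrm_ge0.
rewrite ler_norml; apply/andP; split; rewrite -(ler_pM2l fgp).
  by have := key (- nrm g) (nrm f); rewrite -!nrm2; lra.
by have := key (nrm g) (nrm f); rewrite -!nrm2; lra.
Qed.

Lemma nrmD f g : sqint f -> sqint g ->
  nrm (fun x => f x + g x) <= nrm f + nrm g.
Proof.
move=> sf sg; rewrite -(@ler_pXn2r _ 2)// ?nnegrE ?addr_ge0 ?nrm_ge0//.
have sD := sqintD sf sg.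
rewrite nrm2 ipDr// !(ipC (fun x => _ + _)) !ipDr// (ipC g f) -!nrm2.
have := cauchy_schwarz sf sg; rewrite ler_norml => /andP[_]; nra.
Qed.

Lemma nrmN f : nrm (fun x => - f x) = nrm f.
Proof. by rewrite /nrm ip.unlock; under eq_Rintegral do rewrite mulrNN. Qed.

Lemma nrmB f g : sqint f -> sqint g ->
  nrm (fun x => f x - g x) <= nrm f + nrm g.
Proof.
move=> sf sg; rewrite -(nrmN g); apply: (nrmD sf).
by have := sqintZ (-1) sg; congr sqint; apply/funext => x; rewrite mulN1r.
Qed.

Lemma nrm_eq0_ae f : sqint f -> nrm f = 0 -> f = cst 0 %[ae m].
Proof.
move=> sf f0; have := nrm2E sf; rewrite f0 expr0n/= => h.
have := ae_eq_integral_abs m measurableT (measurable_int _ sf.2).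
under eq_integral do rewrite gee0_abs ?lee_fin ?sqr_ge0//.
case=> [/(_ (esym h)) H _].
apply: filterS H => x /(_ I) /= [] /eqP; rewrite sqrf_eq0 => /eqP fx _.
exact: fx.
Qed.

Lemma ip_ae f g z : sqint f -> sqint g -> sqint z ->
  f = g %[ae m] -> ip m z f = ip m z g.
Proof.
move=> sf sg sz fg; rewrite ip.unlock /Rintegral; congr fine.
apply: ae_eq_integral => //; [exact: (measurable_int _ (sqint_mul sz sf))|
  exact: (measurable_int _ (sqint_mul sz sg))|].
by apply: filterS fg => x fgx _; rewrite fgx.
Qed.

Lemma nrm_ae f g : sqint f -> sqint g -> f = g %[ae m] -> nrm f = nrm g.
Proof.
move=> sf sg fg; rewrite /nrm (ip_ae sf sg sf fg) ipC.
by rewrite (ip_ae sf sg sg fg).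
Qed.

Lemma nrm_sub_weak f g : sqint f -> sqint g ->
  (forall z, sqint z -> ip m z f = ip m z g) -> nrm (fun x => f x - g x) = 0.
Proof.
move=> sf sg fg; have sB := sqintB sf sg.
by rewrite /nrm ipBr// fg// subrr sqrtr0.
Qed.

(** The form in which all identities in L^2 are proved: operators enter only
through bilinear forms, which are additive without exceptional null sets. *)
Lemma ip_weak_eq f g : sqint f -> sqint g ->
  (forall z, sqint z -> ip m z f = ip m z g) -> f = g %[ae m].
Proof.
move=> sf sg fg.
have := nrm_eq0_ae (sqintB sf sg) (nrm_sub_weak sf sg fg).
by apply: filterS => x h _; apply/eqP; rewrite -subr_eq0 h.
Qed.

End RealL2.

Lemma sqint_cst_lty d (T : measurableType d) (R : realType)
    (m : {measure set T -> \bar R}) c :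
  (m setT < +oo)%E -> sqint m (cst c).
Proof.
move=> moo; apply: sqintP => //.
rewrite (_ : (fun x => _) = cst (c ^+ 2)%:E)// integral_cst// lte_mul_pinfty//.
by rewrite lee_fin sqr_ge0.
Qed.

Lemma sqint_cst d (T : measurableType d) (R : realType) (P : probability T R) c :
  sqint P (cst c).
Proof.
apply: sqint_cst_lty; apply: (@le_lt_trans _ _ 1%E); last exact: ltry.
exact: probability_le1.
Qed.

(** * Integrals of families of square-integrable functions *)

(** Without integrability Fubini's theorem does not apply, so measurability is read
off from the positive and negative parts of z k. *)
Lemma measurable_ip_section d1 d2 (T1 : measurableType d1)
    (T2 : measurableType d2) (R : realType) (m : probability T2 R)
    (k : T1 * T2 -> R) (z : T2 -> R) :
  measurable_fun setT k -> measurable_fun setT z ->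
  measurable_fun setT (fun s => ip m z (fun w => k (s, w))).
Proof.
move=> mk mz; pose f p := (z p.2 * k p)%:E.
have mf : measurable_fun setT f.
  apply/measurable_EFinP; apply: measurable_funM => //.
  exact: measurableT_comp mz measurable_snd.
rewrite (_ : (fun s => _) = fine \o
  (fun s => \int[m]_w f^\+ (s, w) - \int[m]_w f^\- (s, w))%E).
  apply: measurableT_comp => //; apply: emeasurable_funB.
    by apply: measurable_fun_fubini_tonelli_F => //; exact: measurable_funepos.
  by apply: measurable_fun_fubini_tonelli_F => //; exact: measurable_funeneg.
apply/funext => s; rewrite ip.unlock /Rintegral /= integralE; congr (fine (_ - _)%E).
  by apply: eq_integral => w _; rewrite !funeposE.
by apply: eq_integral => w _; rewrite !funenegE.
Qed.

(** The function \int_D k_s ds, when k is jointly measurable and the k_s are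
uniformly bounded in L^2(m): a concrete version of the Bochner integral. *)
Section L2Integral.
Context d1 d2 (T1 : measurableType d1) (T2 : measurableType d2) (R : realType).
Variables (nu : {sigma_finite_measure set T1 -> \bar R}) (m : probability T2 R).
Variables (D : set T1) (k : T1 * T2 -> R) (C : R).
Hypotheses (mD : measurable D) (Dfin : (nu D < +oo)%E).
Hypothesis mk : measurable_fun setT k.
Hypothesis kC : forall s, D s -> (\int[m]_w (k (s, w) ^+ 2)%:E <= C%:E)%E.

Definition param_int (w : T2) : R := \int[nu]_(s in D) k (s, w).

Lemma sqint_section s : D s -> sqint m (fun w => k (s, w)).
Proof.
move=> Ds; apply: sqintP; first exact: measurableT_comp mk _.
exact: (le_lt_trans (kC Ds) (ltry _)).
Qed.

(** Extension by 0 outside D, so as to apply Fubini on the whole product. *)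
Let k' (p : T1 * T2) := \1_D p.1 * k p.

Let mk' : measurable_fun setT k'.
Proof.
apply: measurable_funM => //.
by apply: measurableT_comp => //; exact: measurable_indic.
Qed.

Let k'E s w : k' (s, w) = \1_D s * k (s, w).
Proof. by []. Qed.

Let sqint_k' s : sqint m (fun w => k' (s, w)).
Proof.
have [Ds|Ds] := pselect (D s).
  by have := sqintZ (\1_D s) (sqint_section Ds).
have -> : (fun w => k' (s, w)) = cst 0.
  by apply/funext => w; rewrite k'E indicE memNset// mul0r.
exact: sqint_cst.
Qed.

Let int_k' z : sqint m z ->
  (nu \x m)%E.-integrable setT (fun p => (z p.2 * k' p)%:E).
Proof.
move=> sz; have mz : measurable_fun setT (fun p : T1 * T2 => (z p.2 * k' p)%:E).
  apply/measurable_EFinP; apply: measurable_funM => //.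
  by apply: measurableT_comp; [exact: sqint_meas sz|exact: measurable_snd].
apply/integrable12ltyP => //.
pose M : R := nrm m z ^+ 2 + `|C|.
have M0 : 0 <= M by rewrite addr_ge0 ?sqr_ge0.
apply: (@le_lt_trans _ _ (\int[nu]_(s in D) M%:E)%E); last first.
  by rewrite integral_cst//; apply: lte_mul_pinfty.
rewrite [leRHS]integral_mkcond; apply: ge0_le_integral => //.
- by move=> s _; exact: integral_ge0.
- by apply: (measurable_fun_fubini_tonelli_F
    (fun p => `|(z p.2 * k' p)%:E|)%E) => //; exact: measurableT_comp.
- by apply: (measurable_restrictT _ mD).1.
move=> s _; rewrite patchE; case: ifPn => sD; last first.
  rewrite integral0_eq// => w _ /=.
  by rewrite k'E indicE (negbTE sD) mul0r mulr0 normr0.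
have Ds := set_mem sD.
apply: (@le_trans _ _ (\int[m]_w ((z w ^+ 2)%:E + (k (s, w) ^+ 2)%:E))%E).
  have mzz := measurable_funX 2 (sqint_meas sz).
  have mkk := measurable_funX 2 (sqint_meas (sqint_section Ds)).
  apply: ge0_le_integral => //.
  - apply: measurableT_comp => //; apply/measurable_EFinP.
    exact: (measurable_funM (sqint_meas sz) (sqint_meas (sqint_k' s))).
  - by apply: emeasurable_funD; exact/measurable_EFinP.
  move=> w _; rewrite -EFinD /= k'E indicE sD mul1r lee_fin normrM.
  rewrite -(real_normK (num_real (z w))) -(real_normK (num_real (k (s, w)))).
  have := normr_ge0 (z w); have := normr_ge0 (k (s, w)).
  set a := `|k _|; set b := `|z w|; nra.
rewrite ge0_integralD//; first last.
- by apply/measurable_EFinP/measurable_funX/(sqint_meas (sqint_section Ds)).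
- by move=> w _; rewrite lee_fin sqr_ge0.
- by apply/measurable_EFinP/measurable_funX/(sqint_meas sz).
- by move=> w _; rewrite lee_fin sqr_ge0.
rewrite -(nrm2E sz) /M EFinD; apply: leeD => //.
by apply: (le_trans (kC Ds)); rewrite lee_fin ler_norm.
Qed.

Let param_intE w : param_int w = \int[nu]_s k' (s, w).
Proof.
rewrite /param_int Rintegral_mkcond; apply: eq_Rintegral => s _.
by rewrite patchE k'E indicE; case: (s \in D); rewrite ?mul1r ?mul0r.
Qed.

Let mparam_int : measurable_fun setT param_int.
Proof.
have -> : param_int = fine \o (fubini_G nu (fun p => (1 * k' p)%:E)).
  apply/funext => w; rewrite param_intE /=; congr fine.
  by apply: eq_integral => s _; rewrite mul1r.
apply: measurableT_comp => //; apply: measurable_fubini_G.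
exact: (int_k' (sqint_cst _ 1)).
Qed.

Let sqint_indic : sqint nu (\1_D : T1 -> R).
Proof.
apply: sqintP => //; rewrite (eq_integral (fun s => (\1_D s)%:E)).
  by rewrite integral_indic// setIT.
by move=> s _; rewrite indicE; case: (_ \in _); rewrite ?expr1n ?expr0n.
Qed.

(** Pointwise Cauchy-Schwarz bounds (\int_D k_s ds)^2 by nu(D) \int_D k_s^2 ds,
and the latter is integrable by Tonelli. *)
Lemma sqint_param_int : sqint m param_int.
Proof.
apply: sqintP => //.
have mk2 : measurable_fun setT (fun p => (k' p ^+ 2)%:E).
  by apply/measurable_EFinP/measurable_funX.
(* The constant must not vanish, since the integral it multiplies may be
   infinite. *)
pose c : R := nrm nu (\1_D : T1 -> R) ^+ 2 + 1.
have c0 : 0 < c by rewrite ltr_wpDl// sqr_ge0.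
have le1 w : ((param_int w ^+ 2)%:E <= c%:E * \int[nu]_s (k' (s, w) ^+ 2)%:E)%E.
  have [kw|] := boolP (\int[nu]_s (k' (s, w) ^+ 2)%:E < +oo)%E; last first.
    by rewrite ltey negbK => /eqP ->; rewrite gt0_muley ?lte_fin// leey.
  have sk : sqint nu (fun s => k' (s, w)).
    by apply: sqintP => //; exact: measurableT_comp mk' _.
  rewrite -nrm2E// -EFinM lee_fin.
  have -> : param_int w = ip nu (\1_D : T1 -> R) (fun s => k' (s, w)).
    rewrite param_intE ip.unlock; apply: eq_Rintegral => s _; rewrite k'E indicE.
    by case: (_ \in _); rewrite ?mul1r ?mul0r.
  have h := cauchy_schwarz sqint_indic sk.
  apply: (@le_trans _ _ ((nrm nu (\1_D : T1 -> R)
      * nrm nu (fun s => k' (s, w))) ^+ 2)).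
    by rewrite -[leLHS]real_normK ?num_real// lerXn2r// nnegrE mulr_ge0 ?nrm_ge0.
  rewrite exprMn.
  by rewrite ler_wpM2r ?sqr_ge0// lerDl.
have mG : measurable_fun setT (fun w => \int[nu]_s (k' (s, w) ^+ 2)%:E)%E.
  apply: (measurable_fun_fubini_tonelli_G (fun p => (k' p ^+ 2)%:E)) => //.
  by move=> p; rewrite lee_fin sqr_ge0.
apply: (@le_lt_trans _ _
    (c%:E * \int[m]_w \int[nu]_s (k' (s, w) ^+ 2)%:E)%E).
  rewrite -ge0_integralZl//; last 2 first.
  - by move=> w _; apply: integral_ge0 => s _; rewrite lee_fin sqr_ge0.
  - by rewrite lee_fin ltW.
  apply: ge0_le_integral => //.
  - by move=> w _; rewrite lee_fin sqr_ge0.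
  - exact/measurable_EFinP/measurable_funX.
  - exact: measurable_funeM.
rewrite -(fubini_tonelli (fun p => (k' p ^+ 2)%:E))//; last first.
  by move=> p; rewrite lee_fin sqr_ge0.
apply: lte_mul_pinfty => //; first by rewrite lee_fin ltW.
apply: (@le_lt_trans _ _ (\int[nu]_(s in D) `|C|%:E)%E); last first.
  by rewrite integral_cst//; apply: lte_mul_pinfty.
rewrite [leRHS]integral_mkcond; apply: ge0_le_integral => //.
- by move=> s _; apply: integral_ge0 => w _; rewrite lee_fin sqr_ge0.
- apply: (measurable_fun_fubini_tonelli_F (fun p => (k' p ^+ 2)%:E)) => //.
  by move=> p; rewrite lee_fin sqr_ge0.
- by apply: (measurable_restrictT _ mD).1.
move=> s _; rewrite patchE; case: ifPn => sD; last first.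
  by rewrite integral0_eq// => w _ /=; rewrite k'E indicE (negbTE sD) mul0r expr0n.
under eq_integral do rewrite k'E indicE sD mul1r.
by apply: (le_trans (kC (set_mem sD))); rewrite lee_fin ler_norm.
Qed.

Let fubini_FE z : sqint m z ->
  fubini_F m (fun p => (z p.2 * k' p)%:E)
  = (fun s => (\1_D s * ip m z (fun w => k (s, w)))%:E).
Proof.
move=> sz; apply/funext => s; rewrite /fubini_F ip.unlock /=.
have zk := sqint_mul sz (sqint_k' s).
rewrite -(fineK (integrable_fin_num measurableT zk)); congr EFin.
rewrite -[LHS]/(\int[m]_w (z w * k' (s, w))).
have [sD|sD] := boolP (s \in D); rewrite indicE ?sD ?(negbTE sD).
  rewrite mul1r; apply: eq_Rintegral => w _.
  by rewrite k'E indicE sD mul1r.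
rewrite mul0r; under eq_Rintegral do rewrite k'E indicE (negbTE sD) mul0r mulr0.
by rewrite Rintegral_cst// mul0r.
Qed.

Lemma integrable_ip_section z : sqint m z ->
  nu.-integrable D (fun s => (ip m z (fun w => k (s, w)))%:E).
Proof.
move=> sz; apply/(integrable_mkcond _ mD).
have := integrable_fubini_F (int_k' sz); rewrite fubini_FE//.
apply: eq_integrable => // s _; rewrite patchE indicE.
by case: (_ \in _); rewrite ?mul1r ?mul0r.
Qed.

Lemma ip_param_int z : sqint m z ->
  ip m z param_int = \int[nu]_(s in D) ip m z (fun w => k (s, w)).
Proof.
move=> sz; rewrite Rintegral_mkcond [in LHS]ip.unlock /Rintegral; congr fine.
transitivity (\int[m]_w \int[nu]_s (z w * k' (s, w))%:E)%E.
  apply: ae_eq_integral => //.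
  - by apply/measurable_EFinP/measurable_funM => //; exact: sqint_meas sz.
  - exact: (measurable_fubini_G (int_k' sz)).
  have := ae_integrable2 (int_k' (sqint_cst _ 1)).
  apply: filterS => w; under eq_fun do rewrite mul1r; move=> kw _.
  rewrite param_intE /Rintegral -[X in (z w * X)%R]/(fine _).
  under [RHS]eq_integral do rewrite EFinM.
  by rewrite integralZl// EFinM fineK// integrable_fin_num.
rewrite -(Fubini (int_k' sz)); apply: eq_integral => s _.
have := fubini_FE sz => /(congr1 (fun f => f s)); rewrite /fubini_F /= => ->.
by rewrite patchE indicE; case: (_ \in _); rewrite ?mul1r ?mul0r.
Qed.

(** Minkowski's integral inequality, by testing K = \int k_s ds against itself:
|K|^2 = \int <K, k_s> ds <= |K| \int |k_s| ds. *)
Lemma nrm_param_int_le (b : T1 -> R) : nu.-integrable D (EFin \o b) ->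
  (forall s, D s -> nrm m (fun w => k (s, w)) <= b s) ->
  nrm m param_int <= \int[nu]_(s in D) b s.
Proof.
move=> ib kb; have sK := sqint_param_int.
have I0 : 0 <= \int[nu]_(s in D) b s.
  by apply: Rintegral_ge0 => s /kb; apply: le_trans; exact: nrm_ge0.
have [->//|n0] := eqVneq (nrm m param_int) 0.
have np : 0 < nrm m param_int by rewrite lt_def n0 nrm_ge0.
rewrite -(ler_pM2l np) -expr2 nrm2 ip_param_int// -RintegralZl//.
apply: le_Rintegral => //; first exact: integrable_ip_section.
  exact: (integrableZl _ _ ib).
move=> s Ds; apply: (le_trans (ler_norm _)).
apply: (le_trans (cauchy_schwarz sK (sqint_section Ds))).
by rewrite ler_wpM2l ?nrm_ge0// kb.
Qed.

End L2Integral.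

(** * Integrals over compact intervals *)
Section LebesgueReflection.
Context (R : realType).
Local Notation lam := (@lebesgue_measure R).
Implicit Types (a b c : R) (f : R -> R).

Let mreflect c :
  measurable_fun setT (fun x : measurableTypeR R => c - x : measurableTypeR R).
Proof. exact: measurable_funB. Qed.

Let reflect_preimage c a b :
  (fun x : R => c - x) @^-1` `[a, b]%classic = `[c - b, c - a]%classic.
Proof.
by apply/seteqP; split=> x /=; rewrite !in_itv/= => /andP[? ?]; apply/andP; split; lra.
Qed.

(** Reflections suffice: a translation is a product of two of them. *)
Let lebesgue_reflect c (A : set (measurableTypeR R)) : measurable A ->
  lebesgue_measure A
  = pushforward lam (fun x : measurableTypeR R => c - x : measurableTypeR R) A.
Proof.
move=> mA; apply: lebesgue_measure_unique => //= _ [[a b]] _ <-.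
rewrite /pushforward.
have -> : (fun x : R => c - x) @^-1` `]a, b]%classic = `[c - b, c - a[%classic.
  apply/seteqP; split=> x /=; rewrite !in_itv/= => /andP[? ?]; apply/andP; split; lra.
rewrite !lebesgue_measure_itv/= !lte_fin ltrD2l ltrN2.
by case: ifP => // _; rewrite -!EFinB; congr EFin; lra.
Qed.

Lemma Rintegral_reflect f a b c : measurable_fun setT f ->
  lam.-integrable `[c - b, c - a] (fun x => (f (c - x))%:E) ->
  \int[lam]_(x in `[c - b, c - a]) f (c - x) = \int[lam]_(x in `[a, b]) f x.
Proof.
move=> mf intf; rewrite /Rintegral; congr fine.
rewrite -reflect_preimage.
rewrite -[LHS](@integral_pushforward _ _ _ _ _ _ (mreflect c) lam `[a, b] (fun x => (f x)%:E)).
- apply: eq_measure_integral => //= A mA _; exact/esym/lebesgue_reflect.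
- exact/measurable_EFinP.
- by rewrite reflect_preimage.
- exact: measurable_itv.
Qed.

Lemma mitvcc a b : measurable (`[a, b]%classic : set (measurableTypeR R)).
Proof. exact: measurable_itv. Qed.

Lemma itvcc_lty a b : (lam `[a, b]%classic < +oo)%E.
Proof.
apply: (@le_lt_trans _ _ (lebesgue_measure (`[a, b]%classic : set R))) => //.
by rewrite lebesgue_measure_itv/=; case: ifP => //; rewrite -EFinB ltry.
Qed.

Lemma bounded_integrable_itv f a b (M : R) : measurable_fun setT f ->
  (forall x, `|f x| <= M) -> lam.-integrable `[a, b] (EFin \o f).
Proof.
move=> mf fM; apply: measurable_bounded_integrable => //.
- exact: itvcc_lty.
- exact: measurable_funTS.
- exists M; split; first exact: num_real.
  by move=> x Mx y _ /=; apply: (le_trans (fM y)); exact: ltW.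
Qed.

Lemma Rintegral_shift f a b c (M : R) : measurable_fun setT f ->
  (forall x, `|f x| <= M) ->
  \int[lam]_(x in `[a, b]) f (c + x) = \int[lam]_(x in `[c + a, c + b]) f x.
Proof.
move=> mf fM.
have mr : measurable_fun setT (fun x : R => f (c - x)).
  exact: measurableT_comp mf (mreflect c).
have := @Rintegral_reflect f (c + a) (c + b) c mf.
rewrite !opprD !addrA subrr !add0r => <-; last first.
  exact: (bounded_integrable_itv _ _ mr).
have := @Rintegral_reflect (fun x => f (c - x)) (- b) (- a) 0 mr.
rewrite !sub0r !opprK => <-.
  by apply: eq_Rintegral => x _; rewrite sub0r opprK.
apply: (@bounded_integrable_itv (fun x => f (c - (0 - x))) _ _ M) => //.
by apply: (measurableT_comp mr); exact: (mreflect 0).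
Qed.

Lemma Rintegral_itv_split f a b c : a <= b -> b <= c ->
  lam.-integrable `[a, c] (EFin \o f) ->
  \int[lam]_(x in `[a, c]) f x
  = \int[lam]_(x in `[a, b]) f x + \int[lam]_(x in `[b, c]) f x.
Proof.
move=> ab bc intf; apply/eqP; rewrite addrC -subr_eq; apply/eqP.
rewrite Rintegral_itvB ?bnd_simp// Rintegral_itv_obnd_cbnd//.
apply: integrableS intf => //; exact: subset_itvr.
Qed.

Lemma integrable_cst_itv a b (c : R) :
  lam.-integrable `[a, b] (EFin \o (fun=> c)).
Proof.
exact: (bounded_integrable_itv a b (f := fun=> c) (M := `|c|) (measurable_cst c)
  (fun=> lexx _)).
Qed.

Lemma Rintegral_cst_itv a b (c : R) : a <= b ->
  \int[lam]_(s in `[a, b]) c = (b - a) * c.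
Proof.
move=> ab.
have h : lebesgue_measure (`[a, b]%classic : set R) = (b - a)%:E.
  by move: ab; rewrite le_eqVlt => /predU1P[->|ab];
    rewrite lebesgue_measure_itv/= lte_fin ?ltxx ?subrr ?ab// EFinB.
rewrite (Rintegral_cst lam (mitvcc a b)) mulrC; congr (_ * _).
exact: (congr1 fine h).
Qed.

Lemma integrable_linear_itv a b (c : R) :
  lam.-integrable `[a, b] (EFin \o (fun s => c * s)).
Proof.
apply: measurable_bounded_integrable.
- exact: mitvcc.
- exact: itvcc_lty.
- by apply: measurable_funTS; exact: measurable_funM.
exists (`|c| * (`|a| + `|b|)); split; first exact: num_real.
move=> x Mx y /=; rewrite in_itv/= => /andP[ay yb].
apply: le_trans (ltW Mx); rewrite normrM ler_wpM2l// ler_norml.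
have := ler_norm b; have := ler_norm (- a); rewrite normrN.
have := normr_ge0 a; have := normr_ge0 b; lra.
Qed.

(** The substitution s -> a + b - s turns twice the integral into that of the
constant c (a + b). *)
Lemma Rintegral_linear_itv a b (c : R) : a <= b ->
  \int[lam]_(s in `[a, b]) (c * s) = c * ((b ^+ 2 - a ^+ 2) / 2).
Proof.
move=> ab; have mc : measurable_fun setT (fun s : R => c * s).
  exact: measurable_funM.
have il := integrable_linear_itv a b c.
have e1 : a + b - b = a by rewrite addrK.
have e2 : a + b - a = b by rewrite addrC addKr.
have ir : lam.-integrable `[a, b] (fun s => (c * (a + b - s))%:E).
  have := integrableB (mitvcc a b) (integrable_cst_itv a b (c * (a + b))) il.
  by apply: eq_integrable; [exact: mitvcc|move=> s _ /=; rewrite -EFinB mulrBr].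
have := Rintegral_reflect (a := a) (b := b) (c := a + b) mc.
rewrite e1 e2 => /(_ ir) e.
have := RintegralD (mitvcc a b) ir il; rewrite e.
rewrite (_ : \int[lam]_(x in `[a, b]) (c * (a + b - x) + c * x)
    = (b - a) * (c * (a + b))).
  set I := Rintegral _ _ _; lra.
rewrite -(Rintegral_cst_itv _ ab); apply: eq_Rintegral => s _; ring.
Qed.

End LebesgueReflection.

(** * Mixtures, test functions and restrictions *)

(** If m is the image under g of the mixture of the laws kap z, with z
distributed according to l, then integrals against m are iterated integrals.
It is an instance of the integral formula for the composition of a kernel from
a point and a kernel that ignores this point. *)
Section Mixture.
Context d1 d2 (Z : measurableType d1) (W : measurableType d2) (R : realType).
Variables (l : {finite_measure set Z -> \bar R}) (kap : R.-pker Z ~> W).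

Definition cst_kernel (_ : unit) : {measure set Z -> \bar R} := l.
Let cst_kernel_meas U : measurable U -> measurable_fun setT (cst_kernel ^~ U).
Proof. by []. Qed.
HB.instance Definition _ := isKernel.Build _ _ _ _ _ cst_kernel cst_kernel_meas.
Let cst_kernel_uub : measure_fam_uub cst_kernel.
Proof.
exists (fine (l setT) + 1) => x; rewrite /cst_kernel EFinD fineK ?fin_num_measure//.
by rewrite lteDl ?fin_num_measure// lte01.
Qed.
HB.instance Definition _ :=
  Kernel_isFinite.Build _ _ _ _ _ cst_kernel cst_kernel_uub.

Definition snd_kernel (p : unit * Z) : {measure set W -> \bar R} := kap p.2.
Let snd_kernel_meas U : measurable U -> measurable_fun setT (snd_kernel ^~ U).
Proof.
move=> mU; exact: (measurableT_comp (measurable_kernel kap U mU)).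
Qed.
HB.instance Definition _ := isKernel.Build _ _ _ _ _ snd_kernel snd_kernel_meas.
Let snd_kernel_uub : measure_fam_uub snd_kernel.
Proof. by exists 2 => p; rewrite /snd_kernel prob_kernel lte_fin ltr1n. Qed.
HB.instance Definition _ :=
  Kernel_isFinite.Build _ _ _ _ _ snd_kernel snd_kernel_uub.

Context d3 (V : measurableType d3) (g : W -> V).

Lemma integral_mixture (m : {measure set V -> \bar R}) (f : V -> \bar R) :
  measurable_fun setT g ->
  (forall A, measurable A -> m A = \int[l]_z kap z (g @^-1` A))%E ->
  measurable_fun setT f -> (forall w, 0 <= f w)%E ->
  (\int[m]_w f w = \int[l]_z \int[kap z]_w f (g w))%E.
Proof.
move=> mg hm mf f0.
rewrite -(@integral_kcomp _ _ _ _ _ _ _ cst_kernel snd_kernel tt (f \o g)).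
- rewrite -[RHS](ge0_integral_pushforward mg _ measurableT)//.
  by apply: eq_measure_integral => A mA _; rewrite hm.
- by move=> w; exact: f0.
- exact: measurableT_comp.
Qed.
End Mixture.

Section ComapKernel.
Context d1 d2 d3 (Z : measurableType d1) (S : measurableType d2)
  (W : measurableType d3) (R : realType).
Variables (kap : R.-pker S ~> W) (f : Z -> S).
Implicit Types mf : measurable_fun setT f.

(** The measurability of f is an argument so that the kernel structure can be
inferred from the term itself. *)
Definition comap_kernel of measurable_fun setT f :=
  fun z : Z => kap (f z) : {measure set W -> \bar R}.
Let comap_kernel_meas mf U : measurable U ->
  measurable_fun setT (comap_kernel mf ^~ U).
Proof. by move=> mU; exact: measurableT_comp (measurable_kernel kap U mU) mf. Qed.
HB.instance Definition _ mf :=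
  isKernel.Build _ _ _ _ _ (comap_kernel mf) (@comap_kernel_meas mf).
Let comap_kernel_prob mf z : comap_kernel mf z setT = 1%E.
Proof. exact: prob_kernel. Qed.
HB.instance Definition _ mf :=
  Kernel_isProbability.Build _ _ _ _ _ (comap_kernel mf) (comap_kernel_prob mf).
End ComapKernel.
Arguments integral_mixture {d1 d2 Z W R} l kap {d3 V} g {m f}.

Lemma sqint_le d (T : measurableType d) (R : realType) (m : {measure set T -> \bar R})
    (f g : T -> R) : measurable_fun setT f -> (forall x, `|f x| <= `|g x|) ->
  sqint m g -> sqint m f.
Proof.
move=> mf fg sg; apply: sqintP => //; apply: le_lt_trans (sqint_lty sg).
apply: ge0_le_integral => //.
- by move=> x _; rewrite lee_fin sqr_ge0.
- exact/measurable_EFinP/measurable_funX.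
- exact/measurable_EFinP/measurable_funX/(sqint_meas sg).
move=> x _; rewrite lee_fin -[leLHS]real_normK ?num_real//.
by rewrite -[leRHS]real_normK ?num_real// lerXn2r ?nnegrE.
Qed.

(** Two nonnegative variables with the same integral over every event of
sigma(xi) have the same integral against every test function of xi. *)
Section TestFunctions.
Context d1 d2 (Om : measurableType d1) (S : measurableType d2) (R : realType).
Variables (P : {measure set Om -> \bar R}) (xi : Om -> S)
  (phi psi : Om -> R).
Hypotheses (mxi : measurable_fun setT xi) (mphi : measurable_fun setT phi)
  (mpsi : measurable_fun setT psi).
Hypotheses (phi0 : forall w, 0 <= phi w) (psi0 : forall w, 0 <= psi w).
Hypothesis eq_events : forall A, measurable A ->
  (\int[P]_(w in xi @^-1` A) (phi w)%:E = \int[P]_(w in xi @^-1` A) (psi w)%:E)%E.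

Import HBNNSimple.

Let mpre A : measurable A -> measurable (xi @^-1` A).
Proof. by move=> mA; rewrite -(setTI (_ @^-1` _)); exact: mxi. Qed.

Let nnsfun_test (z : {nnsfun S >-> R}) (f : Om -> R) :
  measurable_fun setT f -> (forall w, 0 <= f w) ->
  (\int[P]_w ((z (xi w))%:E * (f w)%:E)
   = \sum_(r \in range z) r%:E * \int[P]_(w in xi @^-1` (z @^-1` [set r])) (f w)%:E)%E.
Proof.
move=> mf f0.
transitivity (\int[P]_w (\sum_(r \in range z)
    (r%:E * ((EFin \o f) \_ (xi @^-1` (z @^-1` [set r]))) w)))%E.
  apply: eq_integral => w _.
  rewrite (fsbigD1 (z (xi w)))//=; last by exists (xi w).
  rewrite patchE mem_set//= fsbig1 ?adde0// => r [_ /= rz].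
  rewrite patchE memNset ?mule0//=; exact/nesym.
have mr r : measurable (xi @^-1` (z @^-1` [set r])) by exact: mpre.
rewrite ge0_integral_fsum//.
- apply: eq_fsbigr => r /set_mem [s _ <-].
  rewrite ge0_integralZl//; last 3 first.
  + by apply/(measurable_restrictT _ (mr _)).1/measurable_funTS/measurable_EFinP.
  + by move=> w _; rewrite patchE; case: ifP => // _; rewrite lee_fin.
  + by rewrite lee_fin.
  by rewrite [in RHS]integral_mkcond.
- move=> r; apply: measurable_funeM.
  by apply/(measurable_restrictT _ (mr _)).1/measurable_funTS/measurable_EFinP.
- move=> r w _; rewrite patchE; case: ifPn => [|_]; last by rewrite mule0.
  by move=> /set_mem /= <-; rewrite mule_ge0// lee_fin.
Qed.

Let nnsfun_step (z : {nnsfun S >-> R}) :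
  (\int[P]_w ((z (xi w))%:E * (phi w)%:E) = \int[P]_w ((z (xi w))%:E * (psi w)%:E))%E.
Proof.
rewrite !nnsfun_test//; apply: eq_fsbigr => r _.
by rewrite eq_events//; exact: measurable_sfunP.
Qed.

Lemma eq_test_functions (z : S -> \bar R) : measurable_fun setT z ->
  (forall x, 0 <= z x)%E ->
  (\int[P]_w (z (xi w) * (phi w)%:E) = \int[P]_w (z (xi w) * (psi w)%:E))%E.
Proof.
move=> mz z0; pose z_ := nnsfun_approx measurableT mz.
have lim_z (f : Om -> R) : measurable_fun setT f ->
    (forall w, 0 <= f w) ->
    (\int[P]_w (z (xi w) * (f w)%:E)
     = limn (fun n => \int[P]_w ((z_ n (xi w))%:E * (f w)%:E)))%E.
  move=> mf f0; rewrite -monotone_convergence//; first last.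
  - move=> w _ n1 n2 n12; apply: lee_wpmul2r; first by rewrite lee_fin.
    by rewrite lee_fin; have := nd_nnsfun_approx measurableT mz n12 => /lefP/(_ (xi w)).
  - by move=> n w _; rewrite mule_ge0// lee_fin.
  - move=> n; apply: emeasurable_funM; last exact/measurable_EFinP.
    by apply/measurable_EFinP; exact: measurableT_comp.
  apply: eq_integral => w _; apply/esym/cvg_lim => //.
  apply: cvgeZr => //.
  by apply: cvg_nnsfun_approx => // x _; exact: z0.
rewrite !lim_z//; congr (limn _); apply/funext => n; exact: nnsfun_step.
Qed.
End TestFunctions.

Section RestrictedMeasure.
Context d (T : measurableType d) (R : realType) (P : {measure set T -> \bar R}).

Lemma ge0_integral_mrestr F (mF : measurable F) (f : T -> \bar R) :
  measurable_fun setT f -> (forall x, 0 <= f x)%E ->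
  (\int[mrestr P mF]_x f x = \int[P]_(x in F) f x)%E.
Proof.
move=> mf f0.
rewrite [RHS](@eq_measure_integral _ _ _ _ (mrestr P mF)); last first.
  by move=> A mA AF /=; rewrite /mrestr (setIidl AF).
rewrite (@ge0_negligible_integral _ _ _ _ setT (~` F))//.
- by rewrite setTD setCK.
- exact: measurableC.
- by rewrite /= /mrestr classical_sets.setICl measure0.
Qed.
End RestrictedMeasure.

(** * The semigroup on real functions *)
HB.lock Definition Pt d d' (S : measurableType d) (Om : measurableType d')
  (R : realType) (PP : R.-pker S ~> Om) (X : R -> Om -> S) (t : R)
  (u : S -> R) (x : S) : R := \int[PP x]_w u (X t w).

Section MarkovL2.
Context d d' (S : measurableType d) (Om : measurableType d') (R : realType).
Variables (PP : R.-pker S ~> Om) (X : R -> Om -> S) (mu : probability S R).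
Hypotheses (hX : is_markov_process PP X) (hmu : is_invariant PP X mu).
Local Notation Pmu := (path_law PP mu).
Local Notation Pt := (Pt PP X).
Implicit Types (r s t : R) (u v z : S -> R).

(** The paths are jointly measurable only for nonnegative times; freezing them at
time 0 for negative times gives a function that is measurable on the whole product. *)
Definition nneg_path (p : measurableTypeR R * Om) : S := X (Num.max 0 p.1) p.2.

Lemma measurable_nneg_path : measurable_fun setT nneg_path.
Proof.
have := markov_path_measurable hX.
set E := [set u | _] => mX.
have mE : measurable E.
  rewrite [E](_ : _ = [set: measurableTypeR R * Om] `&` fst @^-1` `[0, +oo[).
    by apply: measurable_fst.
  by rewrite setTI; apply/seteqP; split=> u /=; rewrite in_itv/= andbT.
apply: (measurable_comp mE _ mX
  (g := fun p : measurableTypeR R * Om => (Num.max 0 p.1, p.2))).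
  by move=> _ [p _ <-]; rewrite /E /= le_max lexx.
apply: measurable_fun_pair => //.
by apply: measurable_maxr.
Qed.

Lemma nneg_pathE t w : 0 <= t -> nneg_path (t, w) = X t w.
Proof. by move=> t0; rewrite /nneg_path /= max_r. Qed.

Lemma measurable_X t : 0 <= t -> measurable_fun setT (X t).
Proof.
move=> t0; rewrite (_ : X t = fun w => nneg_path (t, w)).
  exact: (measurableT_comp measurable_nneg_path).
by apply/funext => w; rewrite nneg_pathE.
Qed.

Lemma integral_path_law (f : Om -> \bar R) : measurable_fun setT f ->
  (forall w, 0 <= f w)%E ->
  (\int[Pmu]_w f w = \int[mu]_x \int[PP x]_w f w)%E.
Proof.
by move=> mf f0; rewrite (integral_mixture mu PP id).
Qed.

(** Stationarity: X_t has law mu under P_mu. *)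
Lemma integral_X t (f : S -> \bar R) : 0 <= t -> measurable_fun setT f ->
  (forall x, 0 <= f x)%E ->
  (\int[Pmu]_w f (X t w) = \int[mu]_x f x)%E.
Proof.
move=> t0 mf f0; have mXt := measurable_X t0.
rewrite integral_path_law//; last exact: measurableT_comp.
rewrite -(integral_mixture mu PP (X t) (m := mu))// => A mA.
by rewrite hmu.
Qed.

(** Both sides integrate f against two expressions of one measure on S, the law
of X_(t+s) on the event {X_r \in A}; on events this is the Markov property. *)
Lemma ge0_markov r s t A (f : S -> \bar R) : 0 <= r -> r <= t -> 0 <= s ->
  measurable A -> measurable_fun setT f -> (forall x, 0 <= f x)%E ->
  (\int[Pmu]_(w in X r @^-1` A) f (X (t + s) w)
   = \int[Pmu]_(w in X r @^-1` A) \int[PP (X t w)]_w' f (X s w'))%E.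
Proof.
move=> r0 rt s0 mA mf f0; have t0 := le_trans r0 rt.
have mXt := measurable_X t0; have mXs := measurable_X s0.
have mXts := measurable_X (addr_ge0 t0 s0).
have mF : measurable (X r @^-1` A).
  by rewrite -(setTI (_ @^-1` _)); exact: measurable_X.
have mint g : measurable_fun setT g -> (forall x, 0 <= g x)%E ->
    measurable_fun setT (fun w => \int[PP (X t w)]_w' g w')%E.
  move=> mg g0; apply: measurable_fun_integral_kernel => // U mU.
  exact: measurableT_comp (measurable_kernel PP U mU) mXt.
rewrite -!(ge0_integral_mrestr _ mF); last 4 first.
- by apply: (mint (f \o X s)); [exact: measurableT_comp|move=> w; exact: f0].
- by move=> w; exact: integral_ge0.
- exact: measurableT_comp.
- by move=> w; exact: f0.
pose K := comap_kernel PP mXt.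
rewrite -[RHS](integral_mixture (mrestr Pmu mF) K (X s)
  (m := pushforward (mrestr Pmu mF) (X (t + s))))//.
  by rewrite ge0_integral_pushforward.
move=> B mB.
have mXB : measurable (X s @^-1` B) by rewrite -(setTI (_ @^-1` _)); exact: mXs.
have mPP : measurable_fun setT (fun w => PP (X t w) (X s @^-1` B)).
  exact: measurableT_comp (measurable_kernel PP _ mXB) mXt.
rewrite ge0_integral_mrestr// [RHS]integral_mkcond integral_path_law; last 2 first.
- exact/(measurable_restrictT _ mF).1/measurable_funTS.
- by move=> w; rewrite patchE; case: ifP.
rewrite /pushforward /= /mrestr /path_law; apply: eq_integral => x _.
rewrite setIC (markov_property hX)//; first by rewrite [LHS]integral_mkcond.
by apply: sub_sigma_algebra; exists r, A.
Qed.
Lemma ae_X t (Q : S -> Prop) : 0 <= t ->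
  (\forall x \ae mu, Q x) -> \forall w \ae Pmu, Q (X t w).
Proof.
move=> t0 [N [mN N0 QN]]; exists (X t @^-1` N); split.
- by rewrite -(setTI (_ @^-1` _)); exact: measurable_X.
- by rewrite -N0 -(hmu t0 mN).
- by move=> w /= nQ; apply: QN.
Qed.

Lemma integral_X_signed t (f : S -> \bar R) : 0 <= t -> measurable_fun setT f ->
  (\int[Pmu]_w f (X t w) = \int[mu]_x f x)%E.
Proof.
move=> t0 mf; rewrite integralE [RHS]integralE.
congr (_ - _)%E.
  rewrite -(integral_X t0)//; last exact: measurable_funepos.
  by apply: eq_integral => w _; rewrite !funeposE.
rewrite -(integral_X t0)//; last exact: measurable_funeneg.
by apply: eq_integral => w _; rewrite !funenegE.
Qed.

Lemma sqint_X t u : 0 <= t -> sqint mu u -> sqint Pmu (u \o X t).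
Proof.
move=> t0 su; apply: sqintP.
  exact: measurableT_comp (sqint_meas su) (measurable_X t0).
rewrite /= (integral_X t0 (f := fun x => (u x ^+ 2)%:E)); first exact: sqint_lty.
- by apply/measurable_EFinP/measurable_funX/(sqint_meas su).
- by move=> x; rewrite lee_fin sqr_ge0.
Qed.

Lemma ip_X t u v : 0 <= t -> measurable_fun setT u -> measurable_fun setT v ->
  ip Pmu (u \o X t) (v \o X t) = ip mu u v.
Proof.
move=> t0 mU mv; rewrite ip.unlock /Rintegral; congr fine.
rewrite -(integral_X_signed t0)//.
by apply/measurable_EFinP; exact: measurable_funM.
Qed.

Lemma nrm_X t u : 0 <= t -> measurable_fun setT u ->
  nrm Pmu (u \o X t) = nrm mu u.
Proof. by move=> t0 mU; rewrite /nrm ip_X. Qed.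

Let measurable_kernel_path (f : S -> \bar R) : measurable_fun setT f ->
  (forall x, 0 <= f x)%E ->
  measurable_fun setT (fun p : measurableTypeR R * S =>
    \int[PP p.2]_w f (nneg_path (p.1, w)))%E.
Proof.
move=> mf f0.
pose K := comap_kernel PP (@measurable_snd _ _ (measurableTypeR R) S).
apply: (measurable_fun_integral_finite_kernel
  (fun q : (measurableTypeR R * S) * Om => f (nneg_path (q.1.1, q.2))) K).
  by move=> q; exact: f0.
apply: measurableT_comp => //; apply: (measurableT_comp measurable_nneg_path).
apply: measurable_fun_pair => //.
exact: (measurableT_comp measurable_fst measurable_fst).
Qed.

Lemma measurable_Pt_joint u : measurable_fun setT u ->
  measurable_fun setT (fun p : measurableTypeR R * S =>
    Pt (Num.max 0 p.1) u p.2).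
Proof.
move=> mU; have mEu : measurable_fun setT (EFin \o u) by exact/measurable_EFinP.
rewrite (_ : (fun p => _) = fine \o (fun p : measurableTypeR R * S =>
  \int[PP p.2]_w (EFin \o u)^\+ (nneg_path (p.1, w))
  - \int[PP p.2]_w (EFin \o u)^\- (nneg_path (p.1, w)))%E).
  apply: measurableT_comp => //; apply: emeasurable_funB.
    by apply: measurable_kernel_path => //; exact: measurable_funepos.
  by apply: measurable_kernel_path => //; exact: measurable_funeneg.
apply/funext => p; rewrite Pt.unlock /Rintegral /= integralE; congr (fine (_ - _)%E).
  by apply: eq_integral => w _; rewrite !funeposE.
by apply: eq_integral => w _; rewrite !funenegE.
Qed.

Lemma measurable_Pt t u : 0 <= t -> measurable_fun setT u ->
  measurable_fun setT (Pt t u).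
Proof.
move=> t0 mU; rewrite (_ : Pt t u = (fun p : measurableTypeR R * S =>
    Pt (Num.max 0 p.1) u p.2) \o (fun x : S => (t : measurableTypeR R, x))).
  apply: (measurableT_comp (measurable_Pt_joint mU)).
  exact: measurable_fun_pair.
by apply/funext => x /=; rewrite max_r.
Qed.

Let integral_kernel_sqr t u : 0 <= t -> sqint mu u ->
  (\int[mu]_x \int[PP x]_w (u (X t w) ^+ 2)%:E = (nrm mu u ^+ 2)%:E)%E.
Proof.
move=> t0 su; have mu2 : measurable_fun setT (fun x => (u x ^+ 2)%:E).
  by apply/measurable_EFinP/measurable_funX/(sqint_meas su).
have u20 x : (0 <= (u x ^+ 2)%:E)%E by rewrite lee_fin sqr_ge0.
rewrite nrm2E// -(integral_X t0 mu2 u20) integral_path_law//.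
exact: measurableT_comp mu2 (measurable_X t0).
Qed.

Let measurable_kernel_sqr t u : 0 <= t -> sqint mu u ->
  measurable_fun setT (fun x => \int[PP x]_w (u (X t w) ^+ 2)%:E)%E.
Proof.
move=> t0 su; apply: measurable_fun_integral_kernel.
- by move=> U mU; exact: measurable_kernel.
- by move=> w; rewrite lee_fin sqr_ge0.
- apply/measurable_EFinP/measurable_funX.
  exact: measurableT_comp (sqint_meas su) (measurable_X t0).
Qed.

(** For almost every x the value Pt t u x is a genuine expectation, and not the
default value given to the integral of a non-integrable function. *)
Lemma ae_sqint_kernel t u : 0 <= t -> sqint mu u ->
  \forall x \ae mu, sqint (PP x) (u \o X t).
Proof.
move=> t0 su.
have int0 x : (0 <= \int[PP x]_w (u (X t w) ^+ 2)%:E)%E.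
  by apply: integral_ge0 => w _; rewrite lee_fin sqr_ge0.
have : mu.-integrable setT (fun x => \int[PP x]_w (u (X t w) ^+ 2)%:E)%E.
  apply/integrableP; split; first exact: measurable_kernel_sqr.
  under eq_integral do rewrite gee0_abs//.
  by rewrite integral_kernel_sqr// ltry.
move=> /(integrable_ae measurableT); apply: filterS => x /(_ I) fx.
apply: sqintP.
  exact: measurableT_comp (sqint_meas su) (measurable_X t0).
by rewrite ltey_eq fx.
Qed.

Lemma integrable_kernel x (f : Om -> R) : sqint (PP x) f ->
  (PP x).-integrable setT (EFin \o f).
Proof.
move=> sf; have s1 : sqint (PP x) (cst 1).
  by apply: sqint_cst_lty; rewrite prob_kernel ltry.
have := sqint_mul s1 sf.
by apply: eq_integrable => // w _; rewrite /= mul1r.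
Qed.

(** Jensen's inequality (E_x u(X_t))^2 <= E_x u(X_t)^2, integrated with
stationarity. *)
Lemma sqint_Pt t u : 0 <= t -> sqint mu u -> sqint mu (Pt t u).
Proof.
move=> t0 su; apply: sqintP; first exact: measurable_Pt (sqint_meas su).
apply: (@le_lt_trans _ _ (\int[mu]_x \int[PP x]_w (u (X t w) ^+ 2)%:E)%E);
  last by rewrite integral_kernel_sqr// ltry.
apply: ge0_le_integral => //.
- by move=> x _; rewrite lee_fin sqr_ge0.
- exact/measurable_EFinP/measurable_funX/measurable_Pt/(sqint_meas su).
- exact: measurable_kernel_sqr.
move=> x _; have [foo|] := boolP (\int[PP x]_w (u (X t w) ^+ 2)%:E < +oo)%E;
  last by rewrite ltey negbK => /eqP ->; rewrite leey.
have sx : sqint (PP x) (u \o X t).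
  by apply: sqintP => //; exact: measurableT_comp (sqint_meas su) (measurable_X t0).
have s1 : sqint (PP x) (cst 1).
  by apply: sqint_cst_lty; rewrite prob_kernel ltry.
have n1 : nrm (PP x) (cst 1) = 1.
  rewrite /nrm ip.unlock; under eq_Rintegral do rewrite mulr1.
  by rewrite Rintegral_cst// prob_kernel mulr1 sqrtr1.
have := cauchy_schwarz s1 sx; rewrite n1 mul1r => h.
rewrite -(nrm2E sx) lee_fin.
have -> : Pt t u x = ip (PP x) (cst 1) (u \o X t).
  by rewrite Pt.unlock ip.unlock; apply: eq_Rintegral => w _ /=; rewrite mul1r.
by rewrite -[leLHS]real_normK ?num_real// lerXn2r// nnegrE ?nrm_ge0.
Qed.

End MarkovL2.

(** * Markov property and weak form of the semigroup *)
Section MarkovProperty.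
Context d d' (S : measurableType d) (Om : measurableType d') (R : realType).
Variables (PP : R.-pker S ~> Om) (X : R -> Om -> S) (mu : probability S R).
Hypotheses (hX : is_markov_process PP X) (hmu : is_invariant PP X mu).
Local Notation Pmu := (path_law PP mu).
Local Notation Pt := (Pt PP X).
Implicit Types (r s t : R) (u v z : S -> R).

Let pos u x := Num.max (u x) 0.
Let neg u x := Num.max (- u x) 0.

Let posnegE u : u = fun x => pos u x - neg u x.
Proof.
apply/funext => x; rewrite /pos /neg.
by rewrite /Num.max; case: ltP => ?; case: ltP => ?; lra.
Qed.

Let pos0 u x : 0 <= pos u x. Proof. by rewrite le_max lexx orbT. Qed.
Let neg0 u x : 0 <= neg u x. Proof. by rewrite le_max lexx orbT. Qed.

Let sqint_pos u : sqint mu u -> sqint mu (pos u).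
Proof.
move=> su; apply: (sqint_le _ _ su).
  by apply: measurable_maxr => //; exact: sqint_meas su.
move=> x; rewrite (ger0_norm (pos0 _ _)) ge_max normr_ge0 andbT.
exact: ler_norm.
Qed.

Let sqint_neg u : sqint mu u -> sqint mu (neg u).
Proof.
move=> su; apply: (sqint_le _ _ su).
  by apply: measurable_maxr => //; apply: measurableT_comp (sqint_meas su).
move=> x; rewrite (ger0_norm (neg0 _ _)) ge_max normr_ge0 andbT.
by rewrite -normrN ler_norm.
Qed.

Let PtB t u v : 0 <= t -> sqint mu u -> sqint mu v ->
  Pt t (fun x => u x - v x) = (fun x => Pt t u x - Pt t v x) %[ae mu].
Proof.
move=> t0 su sv.
have := ae_sqint_kernel hX hmu t0 su; have := ae_sqint_kernel hX hmu t0 sv.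
apply: filterS2 => x svx sux _; rewrite Pt.unlock.
by rewrite -RintegralB//; [exact: integrable_kernel sux|exact: integrable_kernel svx].
Qed.

Let markov_ip_ge0 r s t u z : 0 <= r -> r <= t -> 0 <= s ->
  sqint mu u -> sqint mu z -> (forall x, 0 <= u x) -> (forall x, 0 <= z x) ->
  ip Pmu (z \o X r) (u \o X (t + s)) = ip Pmu (z \o X r) (Pt s u \o X t).
Proof.
move=> r0 rt s0 su sz u0 z0; have t0 := le_trans r0 rt.
have ts0 := addr_ge0 t0 s0.
rewrite ip.unlock /Rintegral; congr fine.
under eq_integral do rewrite EFinM.
under [RHS]eq_integral do rewrite EFinM.
apply: (@eq_test_functions _ _ _ _ _ Pmu (X r) (u \o X (t + s))
  (Pt s u \o X t) _ _ _ _ _ _ (EFin \o z)).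
- exact: (measurable_X hX).
- exact: sqint_meas (sqint_X hX hmu ts0 su).
- exact: sqint_meas (sqint_X hX hmu t0 (sqint_Pt hX hmu s0 su)).
- by move=> w; exact: u0.
- by move=> w /=; rewrite Pt.unlock; apply: Rintegral_ge0 => w' _; exact: u0.
- move=> A mA.
  rewrite (ge0_markov mu hX r0 rt s0 mA (f := EFin \o u)); last 2 first.
  + exact/measurable_EFinP/(sqint_meas su).
  + by move=> x; rewrite lee_fin.
  have mF : measurable (X r @^-1` A).
    by rewrite -(setTI (_ @^-1` _)); exact: (measurable_X hX).
  apply: ae_eq_integral => //.
  + apply: measurable_funTS; apply: (measurableT_comp (f :=
      fun x => \int[PP x]_w (u (X s w))%:E)%E); last exact: (measurable_X hX).
    apply: measurable_fun_integral_kernel.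
    * by move=> U mU; exact: measurable_kernel.
    * by move=> w; rewrite lee_fin.
    * apply/measurable_EFinP.
      exact: measurableT_comp (sqint_meas su) (measurable_X hX s0).
  + apply/measurable_funTS/measurable_EFinP.
    exact: sqint_meas (sqint_X hX hmu t0 (sqint_Pt hX hmu s0 su)).
  have := ae_X hX hmu t0 (ae_sqint_kernel hX hmu s0 su).
  apply: filterS => w sw _ /=; rewrite Pt.unlock /Rintegral fineK//.
  by apply: integrable_fin_num => //; exact: integrable_kernel sw.
- exact/measurable_EFinP/(sqint_meas sz).
- by move=> x; rewrite lee_fin.
Qed.

(** Conditioning u(X_(t+s)) on the past of t.  Taking r = t expresses P_s through
correlations along the path, and r = 0 gives the semigroup law. *)
Lemma markov_ip r s t u z : 0 <= r -> r <= t -> 0 <= s ->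
  sqint mu u -> sqint mu z ->
  ip Pmu (z \o X r) (u \o X (t + s)) = ip Pmu (z \o X r) (Pt s u \o X t).
Proof.
move=> r0 rt s0 su sz; have t0 := le_trans r0 rt.
have ts0 := addr_ge0 t0 s0.
have sXr f (sf : sqint mu f) := sqint_X hX hmu r0 sf.
have sXt f (sf : sqint mu f) := sqint_X hX hmu t0 sf.
have sXts f (sf : sqint mu f) := sqint_X hX hmu ts0 sf.
have sP f (sf : sqint mu f) := sqint_Pt hX hmu s0 sf.
have key v : sqint mu v -> (forall x, 0 <= v x) ->
    ip Pmu (v \o X r) (u \o X (t + s)) = ip Pmu (v \o X r) (Pt s u \o X t).
  move=> sv v0; have [sp sn] := (sqint_pos su, sqint_neg su).
  have -> : u \o X (t + s) = fun w => (pos u \o X (t + s)) w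
      - (neg u \o X (t + s)) w by rewrite {1}(posnegE u).
  rewrite ipBr; [|exact: sXr|exact: sXts|exact: sXts].
  rewrite (markov_ip_ge0 r0 rt s0 sp sv)// (markov_ip_ge0 r0 rt s0 sn sv)//.
  rewrite -ipBr; [|exact: sXr|exact/sXt/sP|exact/sXt/sP].
  apply: ip_ae; [|exact/sXt/sP|exact: sXr|].
    by apply: sqintB; exact/sXt/sP.
  have := ae_X hX hmu t0 (PtB s0 sp sn); rewrite -posnegE.
  by apply: filterS => w /= h _; rewrite h.
have [sp sn] := (sqint_pos sz, sqint_neg sz).
have -> : z \o X r = fun w => (pos z \o X r) w - (neg z \o X r) w.
  by rewrite {1}(posnegE z).
have [zp zn] := (sXr _ sp, sXr _ sn).
have [sU sV] := (sXts _ su, sXt _ (sP _ su)).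
rewrite (ipC _ _ (u \o _)) (ipC _ _ (Pt s u \o _)) !ipBr//.
rewrite -!(ipC _ (pos z \o _)) -!(ipC _ (neg z \o _)).
by rewrite (key _ sp (pos0 z)) (key _ sn (neg0 z)).
Qed.

(** By stationarity the correlation of z(X_t) and u(X_(t+s)) does not depend on
t.  The case t = 0 reduces linearity and boundedness of P_s to those of the
composition with X_s. *)
Lemma ip_Pt t s u z : 0 <= t -> 0 <= s -> sqint mu u -> sqint mu z ->
  ip mu z (Pt s u) = ip Pmu (z \o X t) (u \o X (t + s)).
Proof.
move=> t0 s0 su sz; rewrite (markov_ip t0 (lexx t) s0 su sz) (ip_X hX hmu t0)//.
  exact: sqint_meas sz.
exact: sqint_meas (sqint_Pt hX hmu s0 su).
Qed.

Lemma ip_Pt_Pt t s u z : 0 <= t -> 0 <= s -> sqint mu u -> sqint mu z ->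
  ip mu z (Pt t (Pt s u)) = ip mu z (Pt (t + s) u).
Proof.
move=> t0 s0 su sz; have sPu := sqint_Pt hX hmu s0 su.
rewrite (ip_Pt (lexx 0) t0 sPu sz) (ip_Pt (lexx 0) (addr_ge0 t0 s0) su sz).
by rewrite !add0r (markov_ip (lexx 0) t0 s0 su sz).
Qed.

Lemma ip_Pt_le t u z : 0 <= t -> sqint mu u -> sqint mu z ->
  `|ip mu z (Pt t u)| <= nrm mu z * nrm mu u.
Proof.
move=> t0 su sz; rewrite (ip_Pt (lexx 0) t0 su sz) add0r.
rewrite -(nrm_X hX hmu (lexx 0) (sqint_meas sz)).
rewrite -(nrm_X hX hmu t0 (sqint_meas su)).
by apply: cauchy_schwarz; exact: (sqint_X hX hmu).
Qed.

Lemma nrm_Pt t u : 0 <= t -> sqint mu u -> nrm mu (Pt t u) <= nrm mu u.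
Proof.
move=> t0 su; have sP := sqint_Pt hX hmu t0 su.
have := ip_Pt_le t0 su sP; rewrite -nrm2 ger0_norm ?sqr_ge0// expr2.
have [->|n0] := eqVneq (nrm mu (Pt t u)) 0; first by rewrite nrm_ge0.
by rewrite ler_pM2l// lt_def n0 nrm_ge0.
Qed.

Lemma ip_PtZ t c u z : 0 <= t -> sqint mu u -> sqint mu z ->
  ip mu z (Pt t (fun x => c * u x)) = c * ip mu z (Pt t u).
Proof.
move=> t0 su sz; rewrite !(ip_Pt (lexx 0) t0)//; last exact: sqintZ.
by rewrite -ipZr//; apply: (sqint_X hX hmu); rewrite ?add0r.
Qed.

Lemma ip_PtB t u v z : 0 <= t -> sqint mu u -> sqint mu v -> sqint mu z ->
  ip mu z (Pt t (fun x => u x - v x)) = ip mu z (Pt t u) - ip mu z (Pt t v).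
Proof.
move=> t0 su sv sz; rewrite !(ip_Pt (lexx 0) t0)//; last exact: sqintB.
by rewrite -ipBr//; apply: (sqint_X hX hmu); rewrite ?add0r.
Qed.

Lemma mean_Pt t u : 0 <= t -> sqint mu u ->
  ip mu (cst 1) (Pt t u) = ip mu (cst 1) u.
Proof.
move=> t0 su; rewrite (ip_Pt (lexx 0) t0 su (sqint_cst mu 1)) add0r.
by rewrite -(ip_X hX hmu t0)//; exact: sqint_meas su.
Qed.

End MarkovProperty.

(** * Time integrals of the semigroup and of the paths *)

(** The operator \int_a^b P_s ds for 0 <= a; replacing negative times by 0 makes
the integrand measurable on the whole product. *)
HB.lock Definition Pt_int d d' (S : measurableType d) (Om : measurableType d')
  (R : realType) (PP : R.-pker S ~> Om) (X : R -> Om -> S) (a b : R)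
  (u : S -> R) : S -> R :=
  param_int (@lebesgue_measure R) `[a, b]
    (fun p : measurableTypeR R * S => Pt PP X (Num.max 0 p.1) u p.2).

Section TimeIntegrals.
Context d d' (S : measurableType d) (Om : measurableType d') (R : realType).
Variables (PP : R.-pker S ~> Om) (X : R -> Om -> S) (mu : probability S R).
Hypotheses (hX : is_markov_process PP X) (hmu : is_invariant PP X mu).
Local Notation Pmu := (path_law PP mu).
Local Notation Pt := (Pt PP X).
Implicit Types (r s t : R) (u v z : S -> R).

Local Notation lam := (@lebesgue_measure R).

Let Ptk u (p : measurableTypeR R * S) : R := Pt (Num.max 0 p.1) u p.2.
Let phi z u s : R := ip mu z (Pt (Num.max 0 s) u).

Local Notation Pt_int := (Pt_int PP X).

Let max00 s : 0 <= Num.max 0 s. Proof. by rewrite le_max lexx. Qed.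

Let Ptk_sqr u s : sqint mu u ->
  (\int[mu]_x (Ptk u (s, x) ^+ 2)%:E <= (nrm mu u ^+ 2)%:E)%E.
Proof.
move=> su; rewrite -(nrm2E (sqint_Pt hX hmu (max00 s) su)) lee_fin.
by rewrite lerXn2r ?nnegrE ?nrm_ge0 ?(nrm_Pt hX hmu (max00 s) su).
Qed.

Let mPtk u : sqint mu u -> measurable_fun setT (Ptk u).
Proof. by move=> su; exact: (measurable_Pt_joint hX (sqint_meas su)). Qed.

Let mphi z u : sqint mu u -> sqint mu z -> measurable_fun setT (phi z u).
Proof.
move=> su sz; exact: (measurable_ip_section mu (mPtk su) (sqint_meas sz)).
Qed.

Let phi_le z u s : sqint mu u -> sqint mu z ->
  `|phi z u s| <= nrm mu z * nrm mu u.
Proof. by move=> su sz; exact: (ip_Pt_le hX hmu). Qed.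

Lemma sqint_Pt_int a b u : sqint mu u -> sqint mu (Pt_int a b u).
Proof.
move=> su; rewrite Pt_int.unlock.
apply: (sqint_param_int (C := nrm mu u ^+ 2) (mitvcc a b) (itvcc_lty a b) (mPtk su)) => //.
by move=> s _; exact: Ptk_sqr.
Qed.

Let ip_Pt_intE a b u z : sqint mu u -> sqint mu z ->
  ip mu z (Pt_int a b u) = \int[lam]_(s in `[a, b]) phi z u s.
Proof.
move=> su sz; rewrite Pt_int.unlock.
apply: (ip_param_int (C := nrm mu u ^+ 2) (mitvcc a b) (itvcc_lty a b) (mPtk su)) => //.
by move=> s _; exact: Ptk_sqr.
Qed.

Lemma ip_Pt_int a b u z : 0 <= a -> sqint mu u -> sqint mu z ->
  ip mu z (Pt_int a b u) = \int[lam]_(s in `[a, b]) ip mu z (Pt s u).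
Proof.
move=> a0 su sz; rewrite (ip_Pt_intE a b su sz); apply: eq_Rintegral => s.
rewrite inE /= in_itv/= /phi => /andP[as_ _].
by rewrite (max_r (le_trans a0 as_)).
Qed.

(** P_h shifts the interval of integration by h, from either side. *)
Lemma Pt_int_Pt a b h u z : 0 <= a -> 0 <= h -> sqint mu u -> sqint mu z ->
  ip mu z (Pt_int a b (Pt h u)) = ip mu z (Pt_int (h + a) (h + b) u).
Proof.
move=> a0 h0 su sz; have sP := sqint_Pt hX hmu h0 su.
rewrite (ip_Pt_int b a0 sP sz) (ip_Pt_intE _ _ su sz).
rewrite -(Rintegral_shift a b h (mphi su sz) (fun s => phi_le s su sz)).
apply: eq_Rintegral => s; rewrite inE /= in_itv/= => /andP[as_ _].
have s0 := le_trans a0 as_.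
rewrite (ip_Pt_Pt hX hmu s0 h0 su sz) /phi (max_r (addr_ge0 h0 s0)).
by rewrite addrC.
Qed.

Lemma Pt_Pt_int a b h u z : 0 <= a -> 0 <= h -> sqint mu u -> sqint mu z ->
  ip mu z (Pt h (Pt_int a b u)) = ip mu z (Pt_int (h + a) (h + b) u).
Proof.
move=> a0 h0 su sz; have sG := sqint_Pt_int a b su.
rewrite (ip_Pt hX hmu (lexx 0) h0 sG sz) add0r.
pose k (p : measurableTypeR R * Om) : R := Ptk u (p.1, X h p.2).
have -> : Pt_int a b u \o X h = param_int lam `[a, b] k by rewrite Pt_int.unlock.
have mk : measurable_fun setT k.
  apply: (measurableT_comp (mPtk su)); apply: measurable_fun_pair => //.
  exact: measurableT_comp (measurable_X hX h0) measurable_snd.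
have sz0 := sqint_X hX hmu (lexx 0) sz.
have kC s : (\int[Pmu]_w (k (s, w) ^+ 2)%:E <= (nrm mu u ^+ 2)%:E)%E.
  have sP := sqint_Pt hX hmu (max00 s) su.
  rewrite -(nrm2E (sqint_X hX hmu h0 sP)) lee_fin.
  rewrite (nrm_X hX hmu h0 (sqint_meas sP)).
  by rewrite lerXn2r ?nnegrE ?nrm_ge0 ?(nrm_Pt hX hmu (max00 s) su).
rewrite (ip_param_int (mitvcc a b) (itvcc_lty a b) mk (fun s _ => kC s) sz0).
rewrite (ip_Pt_intE _ _ su sz).
rewrite -(Rintegral_shift a b h (mphi su sz) (fun s => phi_le s su sz)).
apply: eq_Rintegral => s; rewrite inE /= in_itv/= => /andP[as_ _].
have s0 := le_trans a0 as_.
rewrite /phi (max_r (addr_ge0 h0 s0)) -(ip_Pt_Pt hX hmu h0 s0 su sz).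
rewrite (ip_Pt hX hmu (lexx 0) h0 (sqint_Pt hX hmu s0 su) sz) add0r.
by rewrite /k /Ptk /= (max_r s0).
Qed.

Lemma Pt_int_split a b c u z : a <= b -> b <= c -> sqint mu u -> sqint mu z ->
  ip mu z (Pt_int a c u) = ip mu z (Pt_int a b u) + ip mu z (Pt_int b c u).
Proof.
move=> ab bc su sz; rewrite !(ip_Pt_intE _ _ su sz); apply: Rintegral_itv_split => //.
exact: (bounded_integrable_itv _ _ (mphi su sz) (fun s => phi_le s su sz)).
Qed.

Lemma ip_Pt_intB a b u v z : sqint mu u -> sqint mu v -> sqint mu z ->
  ip mu z (Pt_int a b (fun x => u x - v x))
  = ip mu z (Pt_int a b u) - ip mu z (Pt_int a b v).
Proof.
move=> su sv sz; rewrite (ip_Pt_intE _ _ (sqintB su sv) sz).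
rewrite (ip_Pt_intE _ _ su sz) (ip_Pt_intE _ _ sv sz).
have iu := bounded_integrable_itv a b (mphi su sz) (fun s => phi_le s su sz).
have iv := bounded_integrable_itv a b (mphi sv sz) (fun s => phi_le s sv sz).
rewrite -(RintegralB (mitvcc a b) iu iv); apply: eq_Rintegral => s _.
exact: (ip_PtB hX hmu (max00 s) su sv sz).
Qed.

Lemma ip_Pt_intZ a b c u z : sqint mu u -> sqint mu z ->
  ip mu z (Pt_int a b (fun x => c * u x)) = c * ip mu z (Pt_int a b u).
Proof.
move=> su sz; rewrite (ip_Pt_intE _ _ (sqintZ c su) sz) (ip_Pt_intE _ _ su sz).
have iu := bounded_integrable_itv a b (mphi su sz) (fun s => phi_le s su sz).
rewrite -(RintegralZl c (mitvcc a b) iu); apply: eq_Rintegral => s _.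
exact: (ip_PtZ hX hmu c (max00 s) su sz).
Qed.

Lemma mean_Pt_int a b u : 0 <= a -> a <= b -> sqint mu u ->
  ip mu (cst 1) (Pt_int a b u) = (b - a) * ip mu (cst 1) u.
Proof.
move=> a0 ab su; rewrite (ip_Pt_int b a0 su (sqint_cst mu 1)).
rewrite -(Rintegral_cst_itv _ ab); apply: eq_Rintegral => s.
rewrite inE /= in_itv/= => /andP[as_ _].
exact: (mean_Pt hX hmu (le_trans a0 as_) su).
Qed.

Lemma nrm_Pt_int a b u : a <= b -> sqint mu u ->
  nrm mu (Pt_int a b u) <= (b - a) * nrm mu u.
Proof.
move=> ab su; rewrite -(Rintegral_cst_itv _ ab) Pt_int.unlock.
apply: (nrm_param_int_le (C := nrm mu u ^+ 2) (mitvcc a b) (itvcc_lty a b) (mPtk su)).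
- by move=> s _; exact: Ptk_sqr.
- exact: integrable_cst_itv.
- by move=> s _; exact: (nrm_Pt hX hmu (max00 s) su).
Qed.

(** Minkowski's inequality for \int_a^b (P_s u - u) ds. *)
Lemma nrm_Pt_int_sub a b u (beta : R -> R) : 0 <= a -> a <= b -> sqint mu u ->
  lam.-integrable `[a, b] (EFin \o beta) ->
  (forall s, a <= s -> s <= b -> nrm mu (fun x => Pt s u x - u x) <= beta s) ->
  nrm mu (fun x => Pt_int a b u x - (b - a) * u x)
    <= \int[lam]_(s in `[a, b]) beta s.
Proof.
move=> a0 ab su ibeta ubeta.
pose k (p : measurableTypeR R * S) : R := Ptk u p - u p.2.
have mk : measurable_fun setT k.
  apply: measurable_funB; first exact: mPtk.
  exact: measurableT_comp (sqint_meas su) measurable_snd.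
have sk s : sqint mu (fun x => k (s, x)).
  exact: (sqintB (sqint_Pt hX hmu (max00 s) su) su).
have kC s : (\int[mu]_x (k (s, x) ^+ 2)%:E <= ((nrm mu u + nrm mu u) ^+ 2)%:E)%E.
  rewrite -(nrm2E (sk s)) lee_fin lerXn2r ?nnegrE ?addr_ge0 ?nrm_ge0//.
  have sP := sqint_Pt hX hmu (max00 s) su.
  by apply: (le_trans (nrmB sP su)); rewrite lerD2r (nrm_Pt hX hmu (max00 s) su).
have sK : sqint mu (param_int lam `[a, b] k).
  exact: (sqint_param_int (mitvcc a b) (itvcc_lty a b) mk (fun s _ => kC s)).
have sG : sqint mu (fun x => Pt_int a b u x - (b - a) * u x).
  by apply: sqintB; [exact: sqint_Pt_int|exact: sqintZ].
rewrite (_ : nrm mu _ = nrm mu (param_int lam `[a, b] k)).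
  apply: (nrm_param_int_le (mitvcc a b) (itvcc_lty a b) mk (fun s _ => kC s)) => // s.
  rewrite /= in_itv/= => /andP[as_ sb]; rewrite /k /Ptk /=.
  by rewrite (max_r (le_trans a0 as_)); exact: ubeta.
apply: nrm_ae => //; apply: ip_weak_eq => // z sz.
rewrite (ip_param_int (mitvcc a b) (itvcc_lty a b) mk (fun s _ => kC s) sz).
rewrite ipBr//; [|exact: sqint_Pt_int|exact: sqintZ].
rewrite (ip_Pt_intE _ _ su sz) (ipZr _ sz su) -(Rintegral_cst_itv _ ab).
have iphi := bounded_integrable_itv a b (mphi su sz) (fun s => phi_le s su sz).
rewrite -(RintegralB (mitvcc a b) iphi (integrable_cst_itv a b (ip mu z u))).
apply: eq_Rintegral => s _.
exact: esym (ipBr sz (sqint_Pt hX hmu (max00 s) su) su).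
Qed.

Definition path_int t u : Om -> R :=
  param_int lam `[0, t] (fun p : measurableTypeR R * Om => u (nneg_path X p)).

Section PathAverage.
Variables (t : R) (u : S -> R).
Hypotheses (t0 : 0 <= t) (su : sqint mu u).

Let k (p : measurableTypeR R * Om) : R := u (nneg_path X p).

Let mk : measurable_fun setT k.
Proof. exact: measurableT_comp (sqint_meas su) (measurable_nneg_path hX). Qed.

Let kC s : (\int[Pmu]_w (k (s, w) ^+ 2)%:E <= (nrm mu u ^+ 2)%:E)%E.
Proof.
rewrite -(nrm_X hX hmu (max00 s) (sqint_meas su)).
by rewrite nrm2E//; exact: (sqint_X hX hmu).
Qed.

Lemma sqint_path_int : sqint Pmu (path_int t u).
Proof. exact: (sqint_param_int (mitvcc 0 t) (itvcc_lty 0 t) mk (fun s _ => kC s)). Qed.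

Lemma ip_path_int (z : Om -> R) : sqint Pmu z ->
  ip Pmu z (path_int t u) = \int[lam]_(s in `[0, t]) ip Pmu z (u \o X s).
Proof.
move=> sz; rewrite (ip_param_int (mitvcc 0 t) (itvcc_lty 0 t) mk (fun s _ => kC s) sz).
apply: eq_Rintegral => s; rewrite inE /= in_itv/= => /andP[s0 _].
by congr ip; apply/funext => w; rewrite /k nneg_pathE.
Qed.

(** G = Pt_int 0 t u is the conditional expectation of the path integral Y given
X_0, so |G|^2 = E[G(X_0) Y] and Cauchy-Schwarz applies. *)
Lemma nrm_Pt_int_le_path_int : nrm mu (Pt_int 0 t u) <= nrm Pmu (path_int t u).
Proof.
have sG := sqint_Pt_int 0 t su; have sG0 := sqint_X hX hmu (lexx 0) sG.
have : ip mu (Pt_int 0 t u) (Pt_int 0 t u)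
    = ip Pmu (Pt_int 0 t u \o X 0) (path_int t u).
  rewrite (ip_Pt_int t (lexx 0) su sG) (ip_path_int sG0); apply: eq_Rintegral => s.
  rewrite inE /= in_itv/= => /andP[s0 _].
  by rewrite (ip_Pt hX hmu (lexx 0) s0 su sG) add0r.
rewrite -nrm2 => h.
have := cauchy_schwarz sG0 sqint_path_int; rewrite -h ger0_norm ?sqr_ge0//.
rewrite (nrm_X hX hmu (lexx 0) (sqint_meas sG)) expr2.
have [->|n0] := eqVneq (nrm mu (Pt_int 0 t u)) 0; first by rewrite nrm_ge0.
by rewrite ler_pM2l// lt_def n0 nrm_ge0.
Qed.

(** Split the time integral at s: by the Markov property and stationarity the
correlation of u(X_s) and u(X_r) is <u, P_|r-s| u>. *)
Let ip_path_int_X s : 0 <= s -> s <= t ->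
  ip Pmu (u \o X s) (path_int t u)
  = ip mu u (Pt_int 0 s u) + ip mu u (Pt_int 0 (t - s) u).
Proof.
move=> s0 st; have sX := sqint_X hX hmu s0 su.
have mp := mphi su su; have pl r := phi_le r su su.
have mreflect : measurable_fun setT (fun r => phi u u (s - r)).
  by apply: (measurableT_comp mp); exact: measurable_funB.
have mshift : measurable_fun setT (fun r => phi u u (r - s)).
  by apply: (measurableT_comp mp); exact: measurable_funB.
have past r : 0 <= r -> r <= s ->
    ip Pmu (u \o X s) (u \o X r) = phi u u (s - r).
  move=> r0 rs; have sr : 0 <= s - r by rewrite subr_ge0.
  by rewrite /phi (max_r sr) (ip_Pt hX hmu r0 sr su su) subrKC ipC.
have future r : s <= r ->
    ip Pmu (u \o X s) (u \o X r) = phi u u (r - s).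
  move=> rs; have sr : 0 <= r - s by rewrite subr_ge0.
  by rewrite /phi (max_r sr) (ip_Pt hX hmu s0 sr su su) subrKC.
rewrite (ip_path_int sX) (Rintegral_itv_split s0 st); last first.
  have := integrable_ip_section (mitvcc 0 t) (itvcc_lty 0 t) mk (fun r _ => kC r) sX.
  apply: eq_integrable => // r.
  rewrite inE /= in_itv/= => /andP[r0 _].
  by congr (ip _ _ _)%:E; apply/funext => w; rewrite /k nneg_pathE.
congr (_ + _).
  rewrite (ip_Pt_intE _ _ su su) -(Rintegral_reflect (c := s) mp); last first.
    exact: (bounded_integrable_itv _ _ mreflect (fun r => pl _)).
  rewrite subrr subr0; apply: eq_Rintegral => r.
  by rewrite inE /= in_itv/= => /andP[r0 rs]; exact: past.
rewrite (ip_Pt_intE _ _ su su).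
transitivity (\int[lam]_(x in `[0, t - s]) phi u u (s + x - s)); last first.
  by apply: eq_Rintegral => x _; rewrite addrC addKr.
rewrite (Rintegral_shift _ _ _ mshift (fun r => pl _)) addr0 subrKC.
apply: eq_Rintegral => r.
by rewrite inE /= in_itv/= => /andP[sr _]; exact: future.
Qed.

Lemma nrm_path_int_le (B : R) :
  (forall s, 0 <= s -> s <= t -> ip mu u (Pt_int 0 s u) <= B) ->
  nrm Pmu (path_int t u) ^+ 2 <= 2 * t * B.
Proof.
move=> GB; have sY := sqint_path_int; rewrite nrm2 (ip_path_int sY).
have -> : 2 * t * B = \int[lam]_(s in `[0, t]) (2 * B).
  by rewrite (Rintegral_cst_itv _ t0) subr0; ring.
apply: le_Rintegral => //.
- have := integrable_ip_section (mitvcc 0 t) (itvcc_lty 0 t) mk (fun r _ => kC r) sY.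
  apply: eq_integrable => // r.
  rewrite inE /= in_itv/= => /andP[r0 _].
  by congr (ip _ _ _)%:E; apply/funext => w; rewrite /k nneg_pathE.
- exact: integrable_cst_itv.
move=> s; rewrite /= in_itv/= => /andP[s0 st].
rewrite ipC (ip_path_int_X s0 st) mulr_natl mulr2n lerD// GB// ?subr_ge0//.
by rewrite lerBlDr lerDl.
Qed.

End PathAverage.

End TimeIntegrals.

(** * Complex functions through real and imaginary parts *)

(** The form in which limits at 0 from the right are used for norms, which are
nonnegative. *)
Definition vanishes_at0 (R : realType) (F : R -> R) : Prop :=
  forall e, 0 < e -> exists2 del, 0 < del &
    forall h, 0 < h -> h < del -> F h <= e.

Lemma cvge_at_right0P (R : realType) (F : R -> \bar R) (f : R -> R) :
  (forall h, 0 < h -> F h = (f h)%:E) -> (forall h, 0 < h -> 0 <= f h) ->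
  F h @[h --> 0^'+] --> 0%E <-> vanishes_at0 f.
Proof.
move=> Ff f0; split.
  move=> /fine_cvgP[_ /cvgrPdist_le H] e e0.
  have [del /= del0 Hd] := H e e0; exists del => // h h0 hd.
  have := Hd h; rewrite /= sub0r normrN gtr0_norm// => /(_ hd h0).
  by rewrite /= sub0r normrN Ff//= => /(le_trans (ler_norm _)).
move=> H; apply/fine_cvgP; split.
  near=> h; rewrite Ff//; near: h; exact: nbhs_right_gt.
apply/cvgrPdist_le => e e0; have [del del0 Hd] := H e e0.
near=> h; have h0 : 0 < h by near: h; exact: nbhs_right_gt.
have hd : h < del by near: h; exact: nbhs_right_lt.
by rewrite /= sub0r normrN Ff//= ger0_norm ?f0// Hd.
Unshelve. all: by end_near. Qed.

Section ComplexFunctions.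
Context d (S : measurableType d) (R : realType) (mu : probability S R).
Implicit Types (f g h : S -> R[i]) (u v : S -> R).

Definition re_fun f (x : S) : R := complex.Re (f x).
Definition im_fun f (x : S) : R := complex.Im (f x).
Definition cnorm f : R := Num.sqrt (nrm mu (re_fun f) ^+ 2 + nrm mu (im_fun f) ^+ 2).
Definition of_real u (x : S) : R[i] := (u x)%:C%C.

Lemma re_funB f g : re_fun (fun x => f x - g x) = fun x => re_fun f x - re_fun g x.
Proof. by apply/funext => x; rewrite /re_fun; case: (f x) (g x) => ? ? []. Qed.

Lemma im_funB f g : im_fun (fun x => f x - g x) = fun x => im_fun f x - im_fun g x.
Proof. by apply/funext => x; rewrite /im_fun; case: (f x) (g x) => ? ? []. Qed.

Lemma re_funZ (c : R) f : re_fun (fun x => c%:C%C * f x) = fun x => c * re_fun f x.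
Proof.
by apply/funext => x; rewrite /re_fun; case: (f x) => a b /=; rewrite mul0r subr0.
Qed.

Lemma im_funZ (c : R) f : im_fun (fun x => c%:C%C * f x) = fun x => c * im_fun f x.
Proof.
by apply/funext => x; rewrite /im_fun; case: (f x) => a b /=; rewrite mul0r addr0.
Qed.

Let normc2 (z : R[i]) :
  Normc.normc z ^+ 2 = complex.Re z ^+ 2 + complex.Im z ^+ 2.
Proof. by case: z => a b /=; rewrite sqr_sqrtr// addr_ge0 ?sqr_ge0. Qed.

Let normc_ge0 (z : R[i]) : 0 <= Normc.normc z.
Proof. by case: z => a b; exact: sqrtr_ge0. Qed.

Let L2norm_sqrte f :
  L2norm mu f = sqrte (\int[mu]_x (re_fun f x ^+ 2 + im_fun f x ^+ 2)%:E)%E.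
Proof.
rewrite /L2norm unlock poweR12_sqrt; last first.
  by apply: integral_ge0 => x _; exact: poweR_ge0.
congr sqrte; apply: eq_integral => x _.
by rewrite abse_EFin ger0_norm// poweR_EFin powR_mulrn// normc2.
Qed.

Let integral_sqr_split f : measurable_fun setT (re_fun f) -> measurable_fun setT (im_fun f) ->
  (\int[mu]_x (re_fun f x ^+ 2 + im_fun f x ^+ 2)%:E
   = \int[mu]_x (re_fun f x ^+ 2)%:E + \int[mu]_x (im_fun f x ^+ 2)%:E)%E.
Proof.
move=> mr mi; under eq_integral do rewrite EFinD.
rewrite ge0_integralD//.
- by move=> x _; rewrite lee_fin sqr_ge0.
- exact/measurable_EFinP/measurable_funX.
- by move=> x _; rewrite lee_fin sqr_ge0.
- exact/measurable_EFinP/measurable_funX.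
Qed.

Lemma L2P f : L2 mu f <-> sqint mu (re_fun f) /\ sqint mu (im_fun f).
Proof.
split=> [[[mr mi]]|[sr si]].
  rewrite L2norm_sqrte integral_sqr_split// => foo.
  have : (\int[mu]_x (re_fun f x ^+ 2)%:E + \int[mu]_x (im_fun f x ^+ 2)%:E < +oo)%E.
    by move: foo; set a := (_ + _)%E; case: a => [r _|//|//]; exact: ltry.
  move=> foo'; split; apply: sqintP => //; apply: le_lt_trans foo'.
    by rewrite leeDl// integral_ge0// => x _; rewrite lee_fin sqr_ge0.
  by rewrite leeDr// integral_ge0// => x _; rewrite lee_fin sqr_ge0.
split; first by split; [exact: sqint_meas sr|exact: sqint_meas si].
rewrite L2norm_sqrte (integral_sqr_split (sqint_meas sr) (sqint_meas si)).
by rewrite -!nrm2E// -EFinD /= ltry.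
Qed.

Lemma L2normE f : L2 mu f -> L2norm mu f = (cnorm f)%:E.
Proof.
move=> /L2P[sr si]; rewrite L2norm_sqrte.
rewrite (integral_sqr_split (sqint_meas sr) (sqint_meas si)).
by rewrite -!nrm2E// -EFinD.
Qed.

Lemma cnorm_ge0 f : 0 <= cnorm f. Proof. exact: sqrtr_ge0. Qed.

Lemma cnorm2 f : cnorm f ^+ 2 = nrm mu (re_fun f) ^+ 2 + nrm mu (im_fun f) ^+ 2.
Proof. by rewrite sqr_sqrtr// addr_ge0 ?sqr_ge0. Qed.

Lemma nrm_re_le f : nrm mu (re_fun f) <= cnorm f.
Proof.
by rewrite -(@ler_pXn2r _ 2)// ?nnegrE ?cnorm_ge0 ?nrm_ge0// cnorm2 lerDl sqr_ge0.
Qed.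

Lemma nrm_im_le f : nrm mu (im_fun f) <= cnorm f.
Proof.
by rewrite -(@ler_pXn2r _ 2)// ?nnegrE ?cnorm_ge0 ?nrm_ge0// cnorm2 lerDr sqr_ge0.
Qed.

Lemma cnorm_le f : cnorm f <= nrm mu (re_fun f) + nrm mu (im_fun f).
Proof.
rewrite -(@ler_pXn2r _ 2)// ?nnegrE ?cnorm_ge0 ?addr_ge0 ?nrm_ge0// cnorm2.
by have := nrm_ge0 mu (re_fun f); have := nrm_ge0 mu (im_fun f); nra.
Qed.

Lemma nrm0 : nrm mu (fun _ : S => 0) = 0.
Proof.
rewrite /nrm ip.unlock; under eq_Rintegral do rewrite mulr0.
by rewrite Rintegral_cst// mul0r sqrtr0.
Qed.

Lemma cnorm_eq0_ae f : L2 mu f -> cnorm f = 0 -> f = cst 0 %[ae mu].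
Proof.
move=> /L2P[sr si] F0.
have nr : nrm mu (re_fun f) = 0 by apply/eqP; rewrite eq_le nrm_ge0 -F0 nrm_re_le.
have ni : nrm mu (im_fun f) = 0 by apply/eqP; rewrite eq_le nrm_ge0 -F0 nrm_im_le.
apply: filterS2 (nrm_eq0_ae sr nr) (nrm_eq0_ae si ni) => x hr hi xI.
by have := hr xI; have := hi xI; rewrite /re_fun /im_fun; case: (f x) => a b /= -> ->.
Qed.

Lemma L2B f g : L2 mu f -> L2 mu g -> L2 mu (fun x => f x - g x).
Proof.
move=> /L2P[rf jf] /L2P[rg jg]; apply/L2P.
by rewrite re_funB im_funB; split; exact: sqintB.
Qed.

Lemma cnormB f g : L2 mu f -> L2 mu g ->
  cnorm (fun x => f x - g x) <= 2 * (cnorm f + cnorm g).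
Proof.
move=> /L2P[rf jf] /L2P[rg jg]; apply: (le_trans (cnorm_le _)); rewrite re_funB im_funB.
apply: (le_trans (lerD (nrmB rf rg) (nrmB jf jg))).
have := nrm_re_le f; have := nrm_im_le f; have := nrm_re_le g.
by have := nrm_im_le g; lra.
Qed.

Lemma cnormZ (c : R) f : L2 mu f -> cnorm (fun x => c%:C%C * f x) = `|c| * cnorm f.
Proof.
move=> /L2P[rf jf]; rewrite /cnorm re_funZ im_funZ !nrmZ// !exprMn -mulrDr.
by rewrite sqrtrM ?sqr_ge0// sqrtr_sqr normr_id.
Qed.

Let re_funM (c : R[i]) f : re_fun (fun x => c * f x)
  = fun x => complex.Re c * re_fun f x - complex.Im c * im_fun f x.
Proof. by apply/funext => x; rewrite /re_fun /im_fun; case: c (f x) => ? ? []. Qed.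

Let im_funM (c : R[i]) f : im_fun (fun x => c * f x)
  = fun x => complex.Re c * im_fun f x - (- complex.Im c) * re_fun f x.
Proof.
apply/funext => x; rewrite /re_fun /im_fun; case: c (f x) => ? ? [? ?] /=.
by rewrite mulNr opprK.
Qed.

Lemma L2M (c : R[i]) f : L2 mu f -> L2 mu (fun x => c * f x).
Proof.
move=> /L2P[rf jf]; apply/L2P; rewrite re_funM im_funM.
by split; apply: sqintB; exact: sqintZ.
Qed.

Lemma cnormM (c : R[i]) f : L2 mu f -> cnorm (fun x => c * f x)
  <= 2 * (`|complex.Re c| + `|complex.Im c|) * cnorm f.
Proof.
move=> /L2P[rf jf]; apply: (le_trans (cnorm_le _)); rewrite re_funM im_funM.
apply: (le_trans (lerD (nrmB (sqintZ _ rf) (sqintZ _ jf))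
  (nrmB (sqintZ _ jf) (sqintZ _ rf)))).
rewrite !nrmZ// normrN; have := nrm_re_le f; have := nrm_im_le f.
have := normr_ge0 (complex.Re c); have := normr_ge0 (complex.Im c).
by move: (cnorm f) (nrm _ _) (nrm _ _) => F a b; nra.
Qed.

Lemma cnorm_of_real u : cnorm (of_real u) = nrm mu u.
Proof.
rewrite /cnorm (_ : im_fun (of_real u) = fun=> 0)// (_ : re_fun (of_real u) = u)//.
by rewrite nrm0 expr0n addr0 sqrtr_sqr ger0_norm ?nrm_ge0.
Qed.

Lemma L2_of_real u : sqint mu u -> L2 mu (of_real u).
Proof. by move=> su; apply/L2P; split => //; exact: sqint_cst. Qed.

Lemma L2norm_of_real u : sqint mu u -> L2norm mu (of_real u) = (nrm mu u)%:E.
Proof. by move=> su; rewrite (L2normE (L2_of_real su)) cnorm_of_real. Qed.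

Lemma L20P f : L20 mu f <->
  L2 mu f /\ ip mu (cst 1) (re_fun f) = 0 /\ ip mu (cst 1) (im_fun f) = 0.
Proof.
have e (w : S -> R) : ip mu (cst 1) w = \int[mu]_x w x.
  by rewrite ip.unlock; apply: eq_Rintegral => x _; rewrite mul1r.
rewrite /L20 /cintegral !e; split=> [[Lf []]|[Lf [-> ->]]] //.
Qed.

Lemma vanishes_at0_cnorm (F : R -> S -> R[i]) :
  (forall h : R, 0 < h -> L2 mu (F h)) ->
  L2norm mu (F h) @[h --> (0 : R)^'+] --> 0%E <-> vanishes_at0 (fun h : R => cnorm (F h)).
Proof.
move=> LF; apply: cvge_at_right0P => h h0; first exact: L2normE (LF h h0).
exact: cnorm_ge0.
Qed.

Lemma vanishes_at0_split (F : R -> S -> R[i]) : vanishes_at0 (fun h : R => cnorm (F h)) ->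
  vanishes_at0 (fun h : R => nrm mu (re_fun (F h))) /\
  vanishes_at0 (fun h : R => nrm mu (im_fun (F h))).
Proof.
move=> v; split=> e e0; have [del del0 H] := v e e0; exists del => // h h0 hd;
  apply: le_trans (H h h0 hd); [exact: nrm_re_le|exact: nrm_im_le].
Qed.

End ComplexFunctions.

(** * The generator on real functions *)
Section RealGenerator.
Context d d' (S : measurableType d) (Om : measurableType d') (R : realType).
Variables (PP : R.-pker S ~> Om) (X : R -> Om -> S) (mu : probability S R).
Hypotheses (hX : is_markov_process PP X) (hmu : is_invariant PP X mu).
Local Notation Pt := (Pt PP X).
Implicit Types (r s t : R) (u v z : S -> R).

Local Notation Pt_int := (Pt_int PP X).

Definition real_generator f k := [/\ sqint mu f, sqint mu k &
  vanishes_at0 (fun t => nrm mu (fun x => t^-1 * (Pt t f x - f x) - k x))].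

Let qdiff f t x := t^-1 * (Pt t f x - f x).

Let sqint_qdiff f t : 0 <= t -> sqint mu f -> sqint mu (qdiff f t).
Proof.
move=> t0 sf; apply: sqintZ; exact: sqintB (sqint_Pt hX hmu t0 sf) sf.
Qed.

Lemma real_generatorZ c f k : real_generator f k ->
  real_generator (fun x => c * f x) (fun x => c * k x).
Proof.
move=> [sf sk v]; have scf := sqintZ c sf; have sck := sqintZ c sk.
split=> // e e0; have c0 : 0 < `|c| + 1 by rewrite ltr_wpDl.
have [del del0 H] := v _ (divr_gt0 e0 c0); exists del => // h h0 hd.
have h0' := ltW h0; have sq := sqint_qdiff h0' sf.
have sqc := sqint_qdiff h0' scf.
have sP := sqint_Pt hX hmu h0' sf.
have sPc := sqint_Pt hX hmu h0' scf.
have sqk := sqintB sq sk.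
have := nrm_ae (sqintB sqc sck) (sqintZ c sqk); rewrite /qdiff => ->.
  rewrite (nrmZ c sqk); apply: (@le_trans _ _ ((`|c| + 1) * (e / (`|c| + 1)))).
    by apply: ler_pM; rewrite ?nrm_ge0 ?lerDl//; exact: H h0 hd.
  by rewrite mulrC divfK// gt_eqF.
apply: ip_weak_eq; [exact: sqintB sqc sck|exact: sqintZ|] => z sz.
rewrite (ipZr _ sz sqk) (ipBr sz sqc sck) (ipBr sz sq sk) (ipZr _ sz sk).
rewrite (ipZr _ sz (sqintB sPc scf)) (ipZr _ sz (sqintB sP sf)).
rewrite (ipBr sz sPc scf) (ipBr sz sP sf) (ipZr _ sz sf).
by rewrite (ip_PtZ hX hmu c h0' sf sz) -mulrBr mulrCA -mulrBr.
Qed.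

Lemma real_generatorB f1 k1 f2 k2 : real_generator f1 k1 -> real_generator f2 k2 ->
  real_generator (fun x => f1 x - f2 x) (fun x => k1 x - k2 x).
Proof.
move=> [sf1 sk1 v1] [sf2 sk2 v2].
have sf := sqintB sf1 sf2; have sk := sqintB sk1 sk2.
split=> // e e0; have e20 : 0 < e / 2 by rewrite divr_gt0.
have [d1 d10 H1] := v1 _ e20; have [d2 d20 H2] := v2 _ e20.
exists (Num.min d1 d2); first by rewrite lt_min d10.
move=> h h0; rewrite lt_min => /andP[hd1 hd2].
have h0' := ltW h0; have sq1 := sqint_qdiff h0' sf1.
have sq2 := sqint_qdiff h0' sf2; have sq := sqint_qdiff h0' sf.
have sP1 := sqint_Pt hX hmu h0' sf1; have sP2 := sqint_Pt hX hmu h0' sf2.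
have sP := sqint_Pt hX hmu h0' sf.
have s1 := sqintB sq1 sk1; have s2 := sqintB sq2 sk2.
have := nrm_ae (sqintB sq sk) (sqintB s1 s2); rewrite /qdiff => ->.
  apply: (le_trans (nrmB s1 s2)); rewrite [leRHS]splitr.
  by apply: lerD; [exact: H1 h0 hd1|exact: H2 h0 hd2].
apply: ip_weak_eq; [exact: sqintB sq sk|exact: sqintB|] => z sz.
rewrite (ipBr sz sq sk) (ipBr sz s1 s2) (ipBr sz sq1 sk1) (ipBr sz sq2 sk2).
rewrite (ipBr sz sk1 sk2) (ipZr _ sz (sqintB sP sf)).
rewrite (ipZr _ sz (sqintB sP1 sf1)) (ipZr _ sz (sqintB sP2 sf2)).
rewrite (ipBr sz sP sf) (ipBr sz sP1 sf1) (ipBr sz sP2 sf2) (ipBr sz sf1 sf2).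
rewrite (ip_PtB hX hmu h0' sf1 sf2 sz).
have alg (c p q a b k l : R) : c * (p - q - (a - b)) - (k - l)
  = c * (p - a) - k - (c * (q - b) - l) by ring.
exact: alg.
Qed.

Lemma real_generator_ae f k k' : real_generator f k -> sqint mu k' -> k = k' %[ae mu] ->
  real_generator f k'.
Proof.
move=> [sf sk v] sk' kk; split=> // e e0; have [del del0 H] := v e e0.
exists del => // h h0 hd; have sq := sqint_qdiff (ltW h0) sf.
rewrite -(nrm_ae (sqintB sq sk) (sqintB sq sk')); first exact: H h0 hd.
by apply: filterS kk => x /= kx xI; rewrite kx.
Qed.

Hypothesis Pt_cont : forall u, sqint mu u ->
  vanishes_at0 (fun t => nrm mu (fun x => Pt t u x - u x)).

Let avg u h x := h^-1 * Pt_int 0 h u x.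

Let sqint_avg u h : sqint mu u -> sqint mu (avg u h).
Proof. by move=> su; apply: sqintZ; exact: (sqint_Pt_int hX hmu). Qed.

(** Strong continuity at 0, averaged in time by Minkowski's inequality. *)
Lemma avg_vanishes u : sqint mu u ->
  vanishes_at0 (fun h => nrm mu (fun x => avg u h x - u x)).
Proof.
move=> su e e0; have [del del0 H] := Pt_cont su e0.
exists del => // h h0 hd.
have sG := sqint_Pt_int hX hmu 0 h su.
have -> : (fun x => avg u h x - u x)
    = (fun x => h^-1 * (Pt_int 0 h u x - (h - 0) * u x)).
  by apply/funext => x; rewrite /avg subr0 mulrBr mulKf// gt_eqF.
rewrite (nrmZ _ (sqintB sG (sqintZ (h - 0) su))).
rewrite gtr0_norm ?invr_gt0// ler_pdivrMl//.
apply: le_trans (nrm_Pt_int_sub hX hmu (lexx 0) (ltW h0) su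
  (integrable_cst_itv 0 h e) _) _.
  move=> s; rewrite le_eqVlt => /predU1P[<- _|s0 sh]; last first.
    exact: H s0 (le_lt_trans sh hd).
  rewrite (nrm_sub_weak (sqint_Pt hX hmu (lexx 0) su) su) ?ltW// => z sz.
  rewrite (ip_Pt hX hmu (lexx 0) (lexx 0) su sz) add0r.
  exact: (ip_X hX hmu (lexx 0) (sqint_meas sz) (sqint_meas su)).
by rewrite (Rintegral_cst_itv _ (ltW h0)) subr0.
Qed.

(** Cutting the interval [0, h + T] at h or at T; with [Pt_Pt_int] this reads
P_h G_T - G_T = P_T G_h - G_h. *)
Let Pt_int_shift T h u z : 0 <= T -> 0 <= h -> sqint mu u -> sqint mu z ->
  ip mu z (Pt_int (h + 0) (h + T) u) - ip mu z (Pt_int 0 T u)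
  = ip mu z (Pt_int (T + 0) (T + h) u) - ip mu z (Pt_int 0 h u).
Proof.
move=> T0 h0 su sz; rewrite !addr0 (addrC T h).
have e1 : h <= h + T by rewrite lerDl.
have e2 : T <= h + T by rewrite lerDr.
have alg (i a b c e : R) : i = a + b -> i = c + e -> b - c = e - a by lra.
exact: alg (Pt_int_split hX hmu h0 e1 su sz) (Pt_int_split hX hmu T0 e2 su sz).
Qed.

(** The difference between (P_h G_T u - G_T u) / h and P_T u - u is P_T e - e for
e = G_h u / h - u, which tends to 0. *)
Lemma real_generator_Pt_int T u : 0 <= T -> sqint mu u ->
  real_generator (Pt_int 0 T u) (fun x => Pt T u x - u x).
Proof.
move=> T0 su; have sG := sqint_Pt_int hX hmu 0 T su.
have sTu := sqint_Pt hX hmu T0 su.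
split=> //; first exact: sqintB.
move=> e e0; have e20 : 0 < e / 2 by rewrite divr_gt0.
have [del del0 H] := avg_vanishes su e20.
exists del => // h h0 hd; have h0' := ltW h0.
pose eh x := avg u h x - u x.
have sav := sqint_avg h su.
have seh : sqint mu eh by exact: sqintB.
have sPe := sqint_Pt hX hmu T0 seh.
have sGh := sqint_Pt_int hX hmu 0 h su.
have sq := sqint_qdiff h0' sG.
have sPG := sqint_Pt hX hmu h0' sG.
have := nrm_ae (sqintB sq (sqintB sTu su)) (sqintB sPe seh).
rewrite -/(qdiff (Pt_int 0 T u) h) => -> //.
  apply: (le_trans (nrmB sPe seh)); apply: (@le_trans _ _ (e / 2 + e / 2)).
    by apply: lerD; [apply: (le_trans (nrm_Pt hX hmu T0 seh))|]; exact: H h0 hd.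
  by rewrite -splitr.
apply: ip_weak_eq; [exact: sqintB sq (sqintB sTu su)|exact: sqintB sPe seh|].
move=> z sz.
rewrite (ipBr sz sq (sqintB sTu su)) (ipBr sz sTu su) (ipBr sz sPe seh).
rewrite (ipBr sz sav su) (ip_PtB hX hmu T0 sav su sz).
rewrite (ip_PtZ hX hmu h^-1 T0 sGh sz) (ipZr _ sz sGh) (ipZr _ sz (sqintB sPG sG)).
rewrite (ipBr sz sPG sG) (Pt_Pt_int hX hmu T (lexx 0) h0' su sz).
rewrite (Pt_Pt_int hX hmu h (lexx 0) T0 su sz).
have alg (c p g q a y w : R) : p - g = q - a ->
    c * (p - g) - (y - w) = c * q - y - (c * a - w) by move=> ->; ring.
exact: alg (Pt_int_shift T0 h0' su sz).
Qed.

(** P_h preserves the mean, so the difference quotients have mean zero. *)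
Lemma real_generator_mean f k : real_generator f k -> ip mu (cst 1) k = 0.
Proof.
move=> [sf sk v]; have s1 := sqint_cst mu (1 : R).
apply/eqP; rewrite -normr_le0; apply/ler_addgt0Pl => e e0; rewrite addr0.
have n0 : 0 < nrm mu (cst 1) + 1 by rewrite ltr_wpDl// nrm_ge0.
have [del del0 H] := v _ (divr_gt0 e0 n0).
pose h := del / 2; have h0 : 0 < h by rewrite divr_gt0.
have hd : h < del by rewrite ltr_pdivrMr// ltr_pMr// ltr1n.
have sq := sqint_qdiff (ltW h0) sf.
have sP := sqint_Pt hX hmu (ltW h0) sf.
have := cauchy_schwarz s1 (sqintB sq sk); rewrite (ipBr s1 sq sk).
rewrite (ipZr _ s1 (sqintB sP sf)) (ipBr s1 sP sf) (mean_Pt hX hmu (ltW h0) sf).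
rewrite subrr mulr0 sub0r normrN => /le_trans; apply.
apply: (@le_trans _ _ ((nrm mu (cst 1) + 1) * (e / (nrm mu (cst 1) + 1)))).
  apply: ler_pM; [exact: nrm_ge0|exact: nrm_ge0|by rewrite lerDl|exact: H h0 hd].
by rewrite mulrC divfK// gt_eqF.
Qed.

(** Apply G_s to the difference quotient: G_s ((P_h f - f) / h) equals
P_s a - a for the average a = G_h f / h, which tends to f. *)
Lemma dynkin_formula f k s z : 0 <= s -> real_generator f k -> sqint mu z ->
  ip mu z (Pt s f) - ip mu z f = ip mu z (Pt_int 0 s k).
Proof.
move=> s0 [sf sk v] sz; apply/eqP; rewrite -subr_eq0 -normr_le0.
apply/ler_addgt0Pl => e e0; rewrite addr0.
pose M := nrm mu z * (2 + s) + 1.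
have M0 : 0 < M by rewrite ltr_wpDl// mulr_ge0 ?nrm_ge0// addr_ge0.
have [d1 d10 H1] := v _ (divr_gt0 e0 M0).
have [d2 d20 H2] := avg_vanishes sf (divr_gt0 e0 M0).
pose h := Num.min d1 d2 / 2.
have m0 : 0 < Num.min d1 d2 by rewrite lt_min d10.
have h0 : 0 < h by rewrite divr_gt0.
have : h < Num.min d1 d2 by rewrite ltr_pdivrMr// ltr_pMr// ltr1n.
rewrite lt_min => /andP[hd1 hd2]; have h0' := ltW h0.
have sq := sqint_qdiff h0' sf.
have sP := sqint_Pt hX hmu h0' sf.
have sPs := sqint_Pt hX hmu s0 sf.
have sG := sqint_Pt_int hX hmu 0 h sf.
have sa := sqint_avg h sf.
have sB1 := sqintB sq sk.
have sB2 := sqintB sa sf.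
have key : ip mu z (Pt s f) - ip mu z f - ip mu z (Pt_int 0 s k)
  = ip mu z (Pt_int 0 s (fun x => qdiff f h x - k x))
    - (ip mu z (Pt s (fun x => avg f h x - f x))
       - ip mu z (fun x => avg f h x - f x)).
  rewrite (ip_Pt_intB hX hmu 0 s sq sk sz) (ip_Pt_intZ hX hmu 0 s _ (sqintB sP sf) sz).
  rewrite (ip_Pt_intB hX hmu 0 s sP sf sz) (Pt_int_Pt hX hmu s (lexx 0) h0' sf sz).
  rewrite (ip_PtB hX hmu s0 sa sf sz) (ipBr sz sa sf).
  rewrite (ip_PtZ hX hmu _ s0 sG sz) (ipZr _ sz sG).
  rewrite (Pt_Pt_int hX hmu h (lexx 0) s0 sf sz).
  have alg (c p p' g q a y w : R) : p' - g = q - a ->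
    p - y - w = c * (p' - g) - w - (c * q - p - (c * a - y)) by move=> ->; ring.
  exact: alg (Pt_int_shift s0 h0' sf sz).
rewrite key.
have b1 : `|ip mu z (Pt_int 0 s (fun x => qdiff f h x - k x))|
    <= nrm mu z * (s * (e / M)).
  apply: (le_trans (cauchy_schwarz sz (sqint_Pt_int hX hmu 0 s sB1))).
  apply: ler_wpM2l; first exact: nrm_ge0.
  apply: (le_trans (nrm_Pt_int hX hmu s0 sB1)); rewrite subr0.
  by apply: ler_wpM2l => //; exact: H1 h0 hd1.
have b2 : `|ip mu z (Pt s (fun x => avg f h x - f x))| <= nrm mu z * (e / M).
  apply: (le_trans (ip_Pt_le hX hmu s0 sB2 sz)).
  by apply: ler_wpM2l; [exact: nrm_ge0|exact: H2 h0 hd2].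
have b3 : `|ip mu z (fun x => avg f h x - f x)| <= nrm mu z * (e / M).
  apply: (le_trans (cauchy_schwarz sz sB2)).
  by apply: ler_wpM2l; [exact: nrm_ge0|exact: H2 h0 hd2].
apply: (le_trans (ler_normB _ _)).
apply: (le_trans (lerD b1 (le_trans (ler_normB _ _) (lerD b2 b3)))).
have -> : nrm mu z * (s * (e / M)) + (nrm mu z * (e / M) + nrm mu z * (e / M))
  = (M - 1) * (e / M) by rewrite /M; ring.
apply: (@le_trans _ _ (M * (e / M))); last by rewrite mulrC divfK// gt_eqF.
by rewrite ler_wpM2r ?divr_ge0 ?(ltW e0) ?(ltW M0)// lerBlDr lerDl.
Qed.

Lemma nrm_Pt_sub f k s : 0 <= s -> real_generator f k ->
  nrm mu (fun x => Pt s f x - f x) = nrm mu (Pt_int 0 s k).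
Proof.
move=> s0 g; have [sf sk _] := g.
have sP := sqint_Pt hX hmu s0 sf.
have sG := sqint_Pt_int hX hmu 0 s sk.
apply: nrm_ae => //; first exact: sqintB.
apply: ip_weak_eq => //; first exact: sqintB.
by move=> z sz; rewrite (ipBr sz sP sf) (dynkin_formula s0 g sz).
Qed.

End RealGenerator.

(** * Complex generator and singular-value gap *)
Section ComplexGenerator.
Context d d' (S : measurableType d) (Om : measurableType d') (R : realType).
Variables (PP : R.-pker S ~> Om) (X : R -> Om -> S) (mu : probability S R).
Hypotheses (hX : is_markov_process PP X) (hmu : is_invariant PP X mu).
Local Notation Pt := (Pt PP X).
Implicit Types (r s t : R) (u v z : S -> R).

Implicit Types (f g h : S -> R[i]).
Local Notation real_generator := (real_generator PP X mu).
Local Notation gap := (singular_value_gap PP X mu).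

Let semigroupE t f x :
  semigroup PP X t f x = Complex (Pt t (re_fun f) x) (Pt t (im_fun f) x).
Proof. by rewrite Pt.unlock. Qed.

Let re_semigroup t f : re_fun (semigroup PP X t f) = Pt t (re_fun f).
Proof. by apply/funext => x; rewrite /re_fun semigroupE. Qed.

Let im_semigroup t f : im_fun (semigroup PP X t f) = Pt t (im_fun f).
Proof. by apply/funext => x; rewrite /im_fun semigroupE. Qed.

Let sqint_quotient u k t : 0 < t -> sqint mu u -> sqint mu k ->
  sqint mu (fun x => t^-1 * (Pt t u x - u x) - k x).
Proof.
move=> t0 su sk; have sP := sqint_Pt hX hmu (ltW t0) su.
exact: sqintB (sqintZ _ (sqintB sP su)) sk.
Qed.

Lemma generatorP f h : generator PP X mu f h <->
  real_generator (re_fun f) (re_fun h) /\ real_generator (im_fun f) (im_fun h).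
Proof.
pose Q t x := (t^-1)%:C%C * (semigroup PP X t f x - f x) - h x.
have rQ t : re_fun (Q t) = fun x => t^-1 * (Pt t (re_fun f) x - re_fun f x) - re_fun h x.
  by rewrite /Q re_funB re_funZ re_funB re_semigroup.
have iQ t : im_fun (Q t) = fun x => t^-1 * (Pt t (im_fun f) x - im_fun f x) - im_fun h x.
  by rewrite /Q im_funB im_funZ im_funB im_semigroup.
have LQ t : 0 < t -> L2 mu f -> L2 mu h -> L2 mu (Q t).
  move=> t0 /L2P[srf sif] /L2P[srh sih]; apply/L2P; rewrite rQ iQ.
  by split; exact: sqint_quotient.
split=> [[Lf Lh cv]|[[srf srh vr] [sif sih vi]]].
  have := (@vanishes_at0_cnorm _ _ _ mu Q (fun _ pos => LQ _ pos Lf Lh)).1 cv.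
  move=> /vanishes_at0_split[vr vi].
  have /L2P[srf sif] := Lf; have /L2P[srh sih] := Lh.
  split; split=> //.
    by move=> e e0; have [del del0 H] := vr e e0; exists del => // t; rewrite -rQ; exact: H.
  by move=> e e0; have [del del0 H] := vi e e0; exists del => // t; rewrite -iQ; exact: H.
have Lf : L2 mu f by apply/L2P.
have Lh : L2 mu h by apply/L2P.
split=> //; apply: (@vanishes_at0_cnorm _ _ _ mu Q (fun _ pos => LQ _ pos Lf Lh)).2.
move=> e e0; have e20 : 0 < e / 2 by rewrite divr_gt0.
have [d1 d10 H1] := vr _ e20; have [d2 d20 H2] := vi _ e20.
exists (Num.min d1 d2); first by rewrite lt_min d10.
move=> t t0; rewrite lt_min => /andP[td1 td2].
apply: (le_trans (cnorm_le mu (Q t))); rewrite rQ iQ [leRHS]splitr.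
by apply: lerD; [exact: H1|exact: H2].
Qed.

Let Pt_0 t : Pt t (fun=> 0) = fun=> 0.
Proof.
apply/funext => x; rewrite Pt.unlock.
by rewrite Rintegral_cst// mul0r.
Qed.

Lemma real_generator0 : real_generator (fun=> 0) (fun=> 0).
Proof.
split; [exact: sqint_cst|exact: sqint_cst|] => e e0; exists 1 => // h h0 _.
rewrite (_ : (fun x => _) = fun=> 0) ?nrm0 ?ltW//.
by apply/funext => x; rewrite Pt_0 subrr mulr0 subrr.
Qed.

Lemma generator_of_real u k : real_generator u k -> generator PP X mu (of_real u) (of_real k).
Proof. by move=> g; apply/generatorP; split => //; exact: real_generator0. Qed.

Lemma strong_continuity : strongly_continuous PP X mu -> forall u, sqint mu u ->
  vanishes_at0 (fun t => nrm mu (fun x => Pt t u x - u x)).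
Proof.
move=> hP u su; have Lu := L2_of_real su.
pose Q t x := semigroup PP X t (of_real u) x - of_real u x.
have rQ t : re_fun (Q t) = fun x => Pt t u x - u x by rewrite /Q re_funB re_semigroup.
have iQ t : im_fun (Q t) = fun=> 0.
  rewrite /Q im_funB im_semigroup (_ : im_fun (of_real u) = fun=> 0)// Pt_0.
  by apply/funext => x; rewrite subrr.
have LQ t : 0 < t -> L2 mu (Q t).
  move=> t0; apply/L2P; rewrite rQ iQ; split; last exact: sqint_cst.
  exact: sqintB (sqint_Pt hX hmu (ltW t0) su) su.
have := (vanishes_at0_cnorm LQ).1 (hP _ Lu); move=> /vanishes_at0_split[v _] e e0.
by have [del del0 H] := v e e0; exists del => // t; rewrite -rQ; exact: H.
Qed.

Lemma gap_le u k : real_generator u k -> ip mu (cst 1) u = 0 -> nrm mu u != 0 ->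
  (gap <= (nrm mu k / nrm mu u)%:E)%E.
Proof.
move=> g m0 u0; have [su sk _] := g; apply: ereal_inf_lbound => /=.
exists (of_real u), (of_real k); split.
- exact: generator_of_real.
- apply/L20P; split; first exact: L2_of_real.
  split=> //; rewrite (_ : im_fun (of_real u) = fun=> 0)//.
  by rewrite ip.unlock; under eq_Rintegral do rewrite mulr0; rewrite Rintegral_cst// mul0r.
- move=> uae; move: u0; rewrite -(nrm0 mu) (nrm_ae su (sqint_cst mu 0)) ?eqxx//.
  apply: filterS uae => x /= h xI; move: (h xI); rewrite /of_real.
  by move=> /(congr1 (@complex.Re R)).
- by rewrite !L2norm_of_real// inver (negbTE u0) -EFinM.
Qed.

Lemma gap_lt_witness (r : R) : (gap < r%:E)%E -> exists f h,
  [/\ generator PP X mu f h, L20 mu f, 0 < cnorm mu f & cnorm mu h < r * cnorm mu f].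
Proof.
move=> /ereal_inf_lt[_ [f [h [g Lf fn0 ->]]]].
have [Lf' Lh _] := g; rewrite (L2normE Lf') (L2normE Lh).
have Fp : 0 < cnorm mu f.
  rewrite lt_def cnorm_ge0 andbT; apply/eqP => F0; apply: fn0.
  exact: cnorm_eq0_ae.
rewrite inver (gt_eqF Fp) -EFinM lte_fin ltr_pdivrMr// => hH.
by exists f, h.
Qed.

End ComplexGenerator.

(** * Upper bound for time averages *)
Section Bounds.
Context d d' (S : measurableType d) (Om : measurableType d') (R : realType).
Variables (PP : R.-pker S ~> Om) (X : R -> Om -> S) (mu : probability S R).
Hypotheses (hX : is_markov_process PP X) (hmu : is_invariant PP X mu).
Local Notation Pmu := (path_law PP mu).
Local Notation Pt := (Pt PP X).
Implicit Types (r s t : R) (u v z : S -> R).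

Implicit Types (f g h : S -> R[i]).
Local Notation Pt_int := (Pt_int PP X).
Local Notation path_int := (path_int X).
Local Notation gap := (singular_value_gap PP X mu).
Local Notation Var := (Var_time_average PP X mu).
Local Notation Delta := (Delta PP X mu).

Hypothesis Pt_cont : forall u, sqint mu u ->
  vanishes_at0 (fun t => nrm mu (fun x => Pt t u x - u x)).

Let time_averageE t g w : time_average X t g w
  = Complex (t^-1 * path_int t (re_fun g) w) (t^-1 * path_int t (im_fun g) w).
Proof.
have rint (u : S -> R) : \int[lebesgue_measure]_(s in `[0, t]) u (X s w)
    = path_int t u w.
  rewrite /path_int /param_int; apply: eq_Rintegral => s.
  by rewrite inE /= in_itv/= => /andP[s0 _]; rewrite nneg_pathE.
rewrite /time_average /cintegral (rint (re_fun g)) (rint (im_fun g)).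
by apply/eqP; rewrite eq_complex /= !mul0r subr0 addr0 !eqxx.
Qed.

Lemma Var_time_averageE t g : 0 < t -> L20 mu g ->
  Var t g = (t^-1 ^+ 2 * (nrm Pmu (path_int t (re_fun g)) ^+ 2
                          + nrm Pmu (path_int t (im_fun g)) ^+ 2))%:E.
Proof.
move=> t0 [/L2P[sr si] mean0].
have sY1 := sqint_path_int hX hmu t sr; have sY2 := sqint_path_int hX hmu t si.
have sZ1 := sqintZ t^-1 sY1; have sZ2 := sqintZ t^-1 sY2.
rewrite /Var_time_average mean0 unlock.
transitivity (\int[Pmu]_w (((t^-1 * path_int t (re_fun g) w) ^+ 2)%:E
    + ((t^-1 * path_int t (im_fun g) w) ^+ 2)%:E))%E.
  apply: eq_integral => w _; rewrite subr0 time_averageE -EFinD /=.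
  by rewrite sqr_sqrtr// addr_ge0 ?sqr_ge0.
rewrite ge0_integralD//.
- rewrite -(nrm2E sZ1) -(nrm2E sZ2) (nrmZ _ sY1) (nrmZ _ sY2) -EFinD.
  by rewrite gtr0_norm ?invr_gt0// !exprMn -mulrDr.
- by move=> w _; rewrite lee_fin sqr_ge0.
- exact/measurable_EFinP/measurable_funX/(sqint_meas sZ1).
- by move=> w _; rewrite lee_fin sqr_ge0.
- exact/measurable_EFinP/measurable_funX/(sqint_meas sZ2).
Qed.

(** The definition of the gap for the vector G_s u, whose image under the
generator is P_s u - u.  Stated for every real c at most the gap so as to cover
an infinite gap. *)
Lemma gap_Pt_int (c : R) s u : 0 < c -> (c%:E <= gap)%E -> 0 <= s ->
  sqint mu u -> ip mu (cst 1) u = 0 ->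
  c * nrm mu (Pt_int 0 s u) <= 2 * nrm mu u.
Proof.
move=> c0 cgap s0 su m0.
have [->|n0] := eqVneq (nrm mu (Pt_int 0 s u)) 0.
  by rewrite mulr0 mulr_ge0// nrm_ge0.
have g := real_generator_Pt_int hX hmu Pt_cont s0 su.
have mG : ip mu (cst 1) (Pt_int 0 s u) = 0.
  by rewrite (mean_Pt_int hX hmu (lexx 0) s0 su) m0 mulr0.
have := le_trans cgap (gap_le hX hmu g mG n0).
rewrite lee_fin ler_pdivlMr ?lt_def ?n0 ?nrm_ge0// => /le_trans; apply.
have sP := sqint_Pt hX hmu s0 su.
apply: (le_trans (nrmB sP su)); rewrite mulr_natl mulr2n lerD2r.
exact: (nrm_Pt hX hmu s0 su).
Qed.

Let nrm_path_int_gap (c : R) t u : 0 < c -> (c%:E <= gap)%E -> 0 <= t ->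
  sqint mu u -> ip mu (cst 1) u = 0 ->
  nrm Pmu (path_int t u) ^+ 2 <= 4 * t / c * nrm mu u ^+ 2.
Proof.
move=> c0 cgap t0 su m0.
have -> : 4 * t / c * nrm mu u ^+ 2 = 2 * t * (nrm mu u * (2 * nrm mu u / c)).
  by field; rewrite gt_eqF.
apply: (nrm_path_int_le hX hmu t0 su) => s s0 _.
apply: le_trans (ler_norm _) _.
apply: (le_trans (cauchy_schwarz su (sqint_Pt_int hX hmu 0 s su))).
apply: ler_wpM2l; first exact: nrm_ge0.
by rewrite ler_pdivlMr// mulrC; exact: gap_Pt_int.
Qed.

Lemma Var_gap_le (c : R) t g : 0 < c -> (c%:E <= gap)%E -> 0 < t ->
  L20 mu g -> L2norm mu g = 1%E -> (Var t g <= (4 / (c * t))%:E)%E.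
Proof.
move=> c0 cgap t0 Lg; have /L20P[Lg' [mr mi]] := Lg.
have /L2P[sr si] := Lg'; rewrite (L2normE Lg') => -[n1].
rewrite Var_time_averageE// lee_fin.
apply: (@le_trans _ _ (t^-1 ^+ 2 * (4 * t / c * cnorm mu g ^+ 2))).
  apply: ler_wpM2l; first exact: sqr_ge0.
  rewrite cnorm2 [leRHS]mulrDr; apply: lerD.
    exact: nrm_path_int_gap c0 cgap (ltW t0) sr mr.
  exact: nrm_path_int_gap c0 cgap (ltW t0) si mi.
rewrite n1 expr1n mulr1 le_eqVlt; apply/orP; left; apply/eqP.
by field; rewrite !gt_eqF.
Qed.

Lemma Delta_le t : (0 < gap)%E -> 0 < t ->
  (Delta t <= 2%:E / sqrte (gap * t%:E))%E.
Proof.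
move=> gap0 t0; apply: ge_ereal_sup => _ [->|[g [Lg n1 ->]]].
  by rewrite mule_ge0// inve_ge0 sqrte_ge0.
have Vg := fun c c0 cg => @Var_gap_le c t g c0 cg t0 Lg n1.
move: Vg; rewrite Var_time_averageE//; set V := _ * _ => Vg.
have [gapy|gapfin] := eqVneq gap +oo%E.
  rewrite gapy gt0_mulye ?lte_fin//= invey mule0 lee_fin.
  rewrite -sqrtr0 ler_wsqrtr//; apply/ler_addgt0Pl => e e0; rewrite addr0.
  have c0 : 0 < 4 / (t * e) by rewrite divr_gt0// mulr_gt0.
  have := Vg _ c0; rewrite gapy leey => /(_ isT); rewrite lee_fin => /le_trans; apply.
  rewrite le_eqVlt; apply/orP; left; apply/eqP.
  by field; rewrite !gt_eqF.
have gapE : gap = (fine gap)%:E.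
  by rewrite fineK// gt0_fin_numE// ltey.
move: gapE; set c := fine gap => gapE; rewrite gapE in gap0 Vg *.
rewrite lte_fin in gap0.
have ct0 : 0 < c * t by rewrite mulr_gt0.
have := Vg c gap0 (lexx _); rewrite lee_fin => Vc.
have sn0 : Num.sqrt (c * t) != 0 by rewrite sqrtr_eq0 -ltNge.
rewrite -EFinM /= inver (negbTE sn0) -EFinM lee_fin.
rewrite -(@ler_pXn2r _ 2)// ?nnegrE ?sqrtr_ge0 ?divr_ge0 ?sqrtr_ge0//.
rewrite sqr_sqrtr; last first.
  by rewrite mulr_ge0 ?sqr_ge0// addr_ge0 ?sqr_ge0.
rewrite expr_div_n sqr_sqrtr ?(ltW ct0)//; apply: le_trans Vc _.
by rewrite expr2 -natrM.
Qed.

End Bounds.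

(** * Lower bound for time averages *)
Section LowerBound.
Context d d' (S : measurableType d) (Om : measurableType d') (R : realType).
Variables (PP : R.-pker S ~> Om) (X : R -> Om -> S) (mu : probability S R).
Hypotheses (hX : is_markov_process PP X) (hmu : is_invariant PP X mu).
Local Notation Pmu := (path_law PP mu).
Local Notation Pt := (Pt PP X).
Implicit Types (r s t : R) (u v z : S -> R).

Implicit Types (f g h : S -> R[i]).
Local Notation Pt_int := (Pt_int PP X).
Local Notation path_int := (path_int X).
Local Notation real_generator := (real_generator PP X mu).
Local Notation gap := (singular_value_gap PP X mu).
Local Notation Var := (Var_time_average PP X mu).
Local Notation Delta := (Delta PP X mu).

Hypothesis Pt_cont : forall u, sqint mu u ->
  vanishes_at0 (fun t => nrm mu (fun x => Pt t u x - u x)).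

Lemma Delta_ge0 t : (0 <= Delta t)%E.
Proof. by apply: ereal_sup_ubound; left. Qed.

Let nrm_Pt_intZ c s u : sqint mu u ->
  nrm mu (Pt_int 0 s (fun x => c * u x)) = `|c| * nrm mu (Pt_int 0 s u).
Proof.
move=> su; have sG := sqint_Pt_int hX hmu 0 s su.
have scG := sqint_Pt_int hX hmu 0 s (sqintZ c su).
rewrite -(nrmZ c sG); apply: (nrm_ae scG (sqintZ c sG)).
apply: (ip_weak_eq scG (sqintZ c sG)) => z sz.
by rewrite (ip_Pt_intZ hX hmu 0 s c su sz) (ipZr c sz sG).
Qed.

Lemma nrm_Pt_int_Delta (D : R) s u : 0 < s -> (Delta s <= D%:E)%E ->
  sqint mu u -> ip mu (cst 1) u = 0 ->
  nrm mu (Pt_int 0 s u) <= s * D * nrm mu u.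
Proof.
move=> s0 DD su m0.
have [n0|n0] := eqVneq (nrm mu u) 0.
  rewrite n0 mulr0; apply: (le_trans (nrm_Pt_int hX hmu (ltW s0) su)).
  by rewrite n0 mulr0.
have np : 0 < nrm mu u by rewrite lt_def n0 nrm_ge0.
pose c := (nrm mu u)^-1; have c0 : 0 < c by rewrite invr_gt0.
pose v x := c * u x; have sv : sqint mu v by exact: sqintZ.
have Lv : L20 mu (of_real v).
  apply/L20P; split; first exact: L2_of_real.
  rewrite (_ : im_fun (of_real v) = cst 0)// (_ : re_fun (of_real v) = v)//.
  rewrite (ipZr c (sqint_cst mu 1) su) m0 mulr0; split=> //.
  rewrite ip.unlock; under eq_Rintegral do rewrite mulr0.
  by rewrite Rintegral_cst// mul0r.
have nv : L2norm mu (of_real v) = 1%E.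
  by rewrite (L2norm_of_real sv) (nrmZ c su) gtr0_norm// mulVf.
have : (sqrte (Var s (of_real v)) <= D%:E)%E.
  by apply: le_trans DD; apply: ereal_sup_ubound; right; exists (of_real v).
rewrite (Var_time_averageE hX hmu s0 Lv) lee_fin => hD.
have D0 : 0 <= D by apply: le_trans hD; exact: sqrtr_ge0.
have hY : nrm Pmu (path_int s v) <= s * D.
  rewrite -ler_pdivrMl//; apply: le_trans hD.
  rewrite -[leLHS]ger0_norm; last by rewrite mulr_ge0 ?nrm_ge0// invr_ge0 ltW.
  rewrite -sqrtr_sqr; apply: ler_wsqrtr; rewrite exprMn.
  by rewrite ler_wpM2l ?sqr_ge0// lerDl sqr_ge0.
have := le_trans (nrm_Pt_int_le_path_int hX hmu s sv) hY.
by rewrite (nrm_Pt_intZ c s su) gtr0_norm// /c ler_pdivrMl// mulrC.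
Qed.

(** The triangle inequality for t u as the difference of \int_t^2t P_s u ds and
\int_t^2t (P_s u - u) ds, with |P_s u - u| = |G_s k| <= s D |k|; the integral of
s over [t, 2t] is 3 t^2 / 2. *)
Lemma nrm_le_Delta (D : R) t u k : 0 < t ->
  (forall s, t <= s -> s <= 2 * t -> (Delta s <= D%:E)%E) ->
  real_generator u k -> ip mu (cst 1) u = 0 ->
  nrm mu u <= D * (3 / 2 * t * nrm mu k + 3 * nrm mu u).
Proof.
move=> t0 DD g m0; have [su sk _] := g; have t0' := ltW t0.
have mk := real_generator_mean hX hmu g.
have t2 : t <= 2 * t by lra.
have t20 : 0 <= 2 * t by lra.
have sG1 := sqint_Pt_int hX hmu 0 t su.
have sG2 := sqint_Pt_int hX hmu 0 (2 * t) su.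
have sG := sqint_Pt_int hX hmu t (2 * t) su.
have stu := sqintZ (2 * t - t) su.
have b1 : nrm mu (fun x => Pt_int t (2 * t) u x - (2 * t - t) * u x)
    <= D * nrm mu k * (((2 * t) ^+ 2 - t ^+ 2) / 2).
  rewrite -Rintegral_linear_itv//; apply: (nrm_Pt_int_sub hX hmu t0' t2 su).
    exact: integrable_linear_itv.
  move=> s ts s2; have s0 := lt_le_trans t0 ts.
  rewrite (nrm_Pt_sub hX hmu Pt_cont (ltW s0) g).
  apply: (le_trans (nrm_Pt_int_Delta s0 (DD s ts s2) sk mk)).
  by rewrite mulrC mulrA mulrAC (mulrC (nrm _ _)) .
have b2 : nrm mu (Pt_int t (2 * t) u) <= 2 * t * D * nrm mu u + t * D * nrm mu u.
  have -> : nrm mu (Pt_int t (2 * t) u)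
      = nrm mu (fun x => Pt_int 0 (2 * t) u x - Pt_int 0 t u x).
    apply: (nrm_ae sG (sqintB sG2 sG1)); apply: (ip_weak_eq sG (sqintB sG2 sG1)) => z sz.
    rewrite (ipBr sz sG2 sG1) (Pt_int_split hX hmu t0' t2 su sz).
    by rewrite addrC addKr.
  apply: (le_trans (nrmB sG2 sG1)); apply: lerD.
    apply: nrm_Pt_int_Delta => //; first lra.
    by apply: DD => //; lra.
  by apply: nrm_Pt_int_Delta => //; exact: DD.
have : t * nrm mu u <= nrm mu (Pt_int t (2 * t) u)
    + nrm mu (fun x => Pt_int t (2 * t) u x - (2 * t - t) * u x).
  rewrite (_ : t * nrm mu u = nrm mu (fun x => (2 * t - t) * u x)); last first.
    by rewrite (nrmZ _ su) (_ : 2 * t - t = t) ?gtr0_norm//; lra.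
  rewrite (_ : nrm mu (fun x => (2 * t - t) * u x) = nrm mu (fun x =>
     Pt_int t (2 * t) u x - (Pt_int t (2 * t) u x - (2 * t - t) * u x))).
    exact: nrmB sG (sqintB sG stu).
  by congr (nrm mu _); apply/funext => x; rewrite subKr.
move: b1 b2; rewrite -(ler_pM2l t0 (nrm mu u)).
move: (nrm mu u) (nrm mu k) (nrm mu (Pt_int _ _ _)) (nrm mu _) => a b p q.
move=> h1 h2 h3; apply: (le_trans h3); apply: (le_trans (lerD h2 h1)).
rewrite le_eqVlt; apply/orP; left; apply/eqP; by field.
Qed.

(** The real inequality reads (1 - 3 D) |u| <= D (3/2) t |k|, and can be squared
and summed over the two components. *)
Lemma cnorm_le_Delta (D : R) t f h : 0 < t -> 0 <= D ->
  (forall s, t <= s -> s <= 2 * t -> (Delta s <= D%:E)%E) ->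
  generator PP X mu f h -> L20 mu f ->
  cnorm mu f <= D * (3 / 2 * t * cnorm mu h + 3 * cnorm mu f).
Proof.
move=> t0 D0 DD /(generatorP hX hmu)[gr gi] /L20P[_ [mr mi]].
have := nrm_le_Delta t0 DD gr mr; have := nrm_le_Delta t0 DD gi mi.
have := cnorm2 mu f; have := cnorm2 mu h; have := cnorm_ge0 mu f; have := cnorm_ge0 mu h.
move: (nrm_ge0 mu (re_fun h)) (nrm_ge0 mu (im_fun h)).
move: (nrm_ge0 mu (re_fun f)) (nrm_ge0 mu (im_fun f)).
move: (nrm mu (re_fun h)) (nrm mu (im_fun h)).
move: (cnorm mu f) (cnorm mu h) (nrm mu (re_fun f)) (nrm mu (im_fun f)).
move=> F H a1 a2 b1 b2 a10 a20 b10 b20 H0 F0 H2 F2 h2 h1.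
have [D3|D3] := leP (1 - 3 * D) 0.
  have : 0 <= D * (3 / 2 * t * H) by rewrite ?mulr_ge0 ?(ltW t0)//.
  nra.
suff : (1 - 3 * D) * F <= D * (3 / 2 * t) * H by lra.
have al0 : 0 <= D * (3 / 2 * t) by rewrite ?mulr_ge0 ?(ltW t0)//.
rewrite -(@ler_pXn2r _ 2)// ?nnegrE ?mulr_ge0 ?(ltW D3) ?(ltW t0)//.
rewrite [leLHS]exprMn [leRHS]exprMn H2 F2 !mulrDr -!exprMn.
apply: lerD; rewrite ler_pXn2r// ?nnegrE ?mulr_ge0 ?(ltW D3) ?(ltW t0)//; lra.
Qed.

Lemma Delta_ge t : (0 < gap)%E -> 0 < t ->
  (((3 / 2 : R)%:E * gap * t%:E + 3%:E)^-1
     <= ereal_sup [set Delta s | s in `[t, (2 * t)%R]])%E.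
Proof.
move=> gap0 t0; set D := ereal_sup _.
have DD s : t <= s -> s <= 2 * t -> (Delta s <= D)%E.
  by move=> ts s2; apply: ereal_sup_ubound; exists s => //=; rewrite in_itv/= ts.
have D0 : (0 <= D)%E by apply: le_trans (Delta_ge0 t) (DD t _ _); lra.
have [gapy|gapfin] := eqVneq gap +oo%E.
  by rewrite gapy gt0_muley ?lte_fin// gt0_mulye ?lte_fin// addye// invey.
have gapE : gap = (fine gap)%:E by rewrite fineK// gt0_fin_numE// ltey.
have [->|Dfin] := eqVneq D +oo%E; first by rewrite leey.
have DE : D = (fine D)%:E by rewrite fineK// ge0_fin_numE// ltey.
move: gapE DE; set c := fine gap; set e := fine D => gapE DE.
rewrite DE in DD D0 *; rewrite gapE in gap0 *.
rewrite lte_fin in gap0; rewrite lee_fin in D0.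
have x0 : 0 < 3 / 2 * c * t + 3 by rewrite addr_gt0// !mulr_gt0.
rewrite -!EFinM -EFinD inver (gt_eqF x0) lee_fin.
rewrite leNgt; apply/negP => lte.
have lt1 : e * (3 / 2 * c * t + 3) < 1 by rewrite -ltr_pdivlMr// mul1r.
pose m := e * (3 / 2 * t) + 1.
have m0 : 0 < m by rewrite ltr_wpDl// ?mulr_ge0 ?(ltW t0)//.
(* So small that e (3/2 (c + eps) t + 3) is still below 1. *)
pose eps := (1 - e * (3 / 2 * c * t + 3)) / m.
have eps0 : 0 < eps by rewrite divr_gt0// subr_gt0.
have : (gap < (c + eps)%:E)%E by rewrite gapE lte_fin ltrDl.
move=> /gap_lt_witness[f [h [g Lf Fp hH]]].
have := cnorm_le_Delta t0 D0 DD g Lf.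
have : e * (3 / 2 * t * cnorm mu h) <= e * (3 / 2 * t * ((c + eps) * cnorm mu f)).
  by rewrite ler_wpM2l// ler_wpM2l ?(ltW hH)// ?mulr_ge0 ?(ltW t0)//.
have : e * (3 / 2 * t) * eps < 1 - e * (3 / 2 * c * t + 3).
  rewrite /eps mulrA ltr_pdivrMr// mulrC ltr_pM2l ?subr_gt0//.
  by rewrite /m ltrDl.
move: (cnorm mu f) (cnorm mu h) Fp => F H Fp l1 l2 l3.
have : (e * (3 / 2 * t) * eps) * F < (1 - e * (3 / 2 * c * t + 3)) * F.
  by rewrite ltr_pM2r.
lra.
Qed.

End LowerBound.

(** * Positivity of the gap *)
Section SpectralGap.
Context d d' (S : measurableType d) (Om : measurableType d') (R : realType).
Variables (PP : R.-pker S ~> Om) (X : R -> Om -> S) (mu : probability S R).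
Hypotheses (hX : is_markov_process PP X) (hmu : is_invariant PP X mu).
Implicit Types (r s t : R) (u v z : S -> R).

Implicit Types (f g h l : S -> R[i]).
Local Notation gap := (singular_value_gap PP X mu).
Local Notation gen := (generator PP X mu).

Let cvg_cnorm (F : nat -> S -> R[i]) : (forall n, L2 mu (F n)) ->
  L2norm mu (F n) @[n --> \oo] --> 0%E ->
  forall e, 0 < e -> exists N, forall n, (N <= n)%N -> cnorm mu (F n) <= e.
Proof.
move=> LF /fine_cvgP[_ /cvgrPdist_le H] e e0.
have [N _ HN] := H e e0; exists N => n Nn.
have := HN n Nn; rewrite /= sub0r normrN (L2normE (LF n)) /=.
by apply: le_trans; exact: ler_norm.
Qed.

Lemma generatorB f1 h1 f2 h2 : gen f1 h1 -> gen f2 h2 ->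
  gen (fun x => f1 x - f2 x) (fun x => h1 x - h2 x).
Proof.
move=> /(generatorP hX hmu)[r1 i1] /(generatorP hX hmu)[r2 i2].
apply/(generatorP hX hmu); rewrite !re_funB !im_funB.
by split; exact: (real_generatorB hX hmu).
Qed.

Lemma generatorZ (c : R) f h : gen f h ->
  gen (fun x => c%:C%C * f x) (fun x => c%:C%C * h x).
Proof.
move=> /(generatorP hX hmu)[r i]; apply/(generatorP hX hmu).
by rewrite !re_funZ !im_funZ; split; exact: (real_generatorZ hX hmu).
Qed.

Lemma generator_ae f h h' : gen f h -> L2 mu h' -> h = h' %[ae mu] -> gen f h'.
Proof.
move=> /(generatorP hX hmu)[r i] /L2P[sr si] hh; apply/(generatorP hX hmu).
split.
  by apply: (real_generator_ae hX hmu r sr); apply: filterS hh => x /= e xI; rewrite /re_fun e.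
by apply: (real_generator_ae hX hmu i si); apply: filterS hh => x /= e xI; rewrite /im_fun e.
Qed.

Let near_kernel n : (gap <= 0)%E -> exists p : (S -> R[i]) * (S -> R[i]),
  [/\ gen p.1 p.2, L20 mu p.1, cnorm mu p.1 = 1 & cnorm mu p.2 <= n.+1%:R^-1].
Proof.
move=> gap0.
have : (gap < (n.+1%:R^-1)%:E)%E.
  by apply: (le_lt_trans gap0); rewrite lte_fin invr_gt0.
move=> /(gap_lt_witness (PP := PP) (X := X))[f [h [g /L20P[Lf [mr mi]] F0 H]]].
have [_ Lh _] := g; pose c := (cnorm mu f)^-1.
have c0 : 0 < c by rewrite invr_gt0.
have /L2P[sr si] := Lf; have s1 := sqint_cst mu (1 : R).
exists (fun x => c%:C%C * f x, fun x => c%:C%C * h x); split => /=.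
- exact: generatorZ.
- apply/L20P; split; first exact: L2M.
  by rewrite re_funZ im_funZ (ipZr c s1 sr) (ipZr c s1 si) mr mi mulr0.
- by rewrite (cnormZ c Lf) gtr0_norm// mulVf// gt_eqF.
- by rewrite (cnormZ c Lh) gtr0_norm// ler_pdivrMl// mulrC ltW.
Qed.

Lemma singular_value_gap_gt0 : compact_resolvent PP X mu ->
  kernel_only_constants PP X mu -> (0 < gap)%E.
Proof.
move=> [lam [[Rex _ [C RC]] Rcpt]] hker; rewrite ltNge; apply/negP => gap0.
have [p hp] := choice (near_kernel^~ gap0).
pose f n := (p n).1; pose h n := (p n).2.
have gfh n : gen (f n) (h n) by have [] := hp n.
have Lf n : L2 mu (f n) by have [] := gfh n.
have Lh n : L2 mu (h n) by have [] := gfh n.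
have f1 n : cnorm mu (f n) = 1 by have [] := hp n.
have hn n : cnorm mu (h n) <= n.+1%:R^-1 by have [] := hp n.
pose g n x := lam * f n x - h n x.
have Lg n : L2 mu (g n) by exact: L2B (L2M lam (Lf n)) (Lh n).
pose K := 2 * (`|complex.Re lam| + `|complex.Im lam|).
have K0 : 0 <= K by rewrite mulr_ge0// addr_ge0.
have Rfg n : resolvent PP X mu lam (g n) (f n).
  by exists (h n); split=> //; exact: aeW.
have gM n : L2 mu (g n) /\ (L2norm mu (g n) <= (2 * (K + 1))%:E)%E.
  split=> //; rewrite (L2normE (Lg n)) lee_fin.
  apply: (le_trans (cnormB (L2M lam (Lf n)) (Lh n))); rewrite ler_wpM2l//.
  apply: lerD; first by apply: (le_trans (cnormM lam (Lf n))); rewrite f1 mulr1.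
  by apply: (le_trans (hn n)); rewrite invf_le1// ler1n.
(* A limit l of a subsequence of the f_n. *)
have [k [l [kincr Ll kcvg]]] := Rcpt g f _ gM Rfg.
have kn n : (n <= k n)%N.
  by elim: n => // n IH; exact: leq_ltn_trans IH (kincr _ _ (ltnSn n)).
have LB n : L2 mu (fun x => f (k n) x - l x) by exact: L2B.
(* The resolvent applied to lambda l, to be identified with l. *)
have [fr [h' [gfr frE]]] := Rex _ (L2M lam Ll).
have [Lfr Lh' _] := gfr.
have approx e : 0 < e -> exists n,
    cnorm mu (fun x => f (k n) x - l x) <= e /\ cnorm mu (h (k n)) <= e.
  move=> e0; have [N HN] := cvg_cnorm LB kcvg e0.
  have [N' HN'] : exists N', N'.+1%:R^-1 <= e.
    have [N' HN'] := ltr_add_invr (y := 0) (x := e) e0.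
    by exists N'; rewrite add0r in HN'; exact: ltW.
  exists (maxn N N'); split; first by apply: HN; exact: leq_maxl.
  apply: (le_trans (hn _)); apply: le_trans HN'.
  rewrite lef_pV2 ?posrE// ler_nat ltnS.
  exact: leq_trans (leq_maxr N N') (kn _).
(* The resolvent is Lipschitz, and f_n - fr is the resolvent of
   lambda (f_n - l) - L f_n. *)
have close n : cnorm mu (fun x => f (k n) x - fr x)
    <= `|C| * (2 * (K * cnorm mu (fun x => f (k n) x - l x) + cnorm mu (h (k n)))).
  pose G x := lam * (f (k n) x - l x) - h (k n) x.
  have LG : L2 mu G by exact: L2B (L2M lam (LB n)) (Lh _).
  have RG : resolvent PP X mu lam G (fun x => f (k n) x - fr x).
    exists (fun x => h (k n) x - h' x); split; first exact: generatorB.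
    apply: filterS frE => x /= e xI; rewrite /G !mulrBr -(e xI); ring.
  have := RC _ _ LG RG; rewrite (L2normE LG) (L2normE (L2B (Lf _) Lfr)).
  rewrite -EFinM lee_fin => /le_trans; apply.
  apply: (@le_trans _ _ (`|C| * cnorm mu G)).
    by rewrite ler_wpM2r ?cnorm_ge0// ler_norm.
  apply: ler_wpM2l => //; apply: (le_trans (cnormB (L2M lam (LB n)) (Lh _))).
  by rewrite ler_wpM2l// lerD2r; exact: cnormM.
have frl0 : cnorm mu (fun x => fr x - l x) = 0.
  apply/eqP; rewrite eq_le cnorm_ge0 andbT; apply/ler_addgt0Pl => e e0; rewrite addr0.
  pose M := 2 * (1 + `|C| * (2 * (K + 1))).
  have M0 : 0 < M by rewrite mulr_gt0// ltr_wpDr// !mulr_ge0// addr_ge0.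
  have [n [n1 n2]] := approx _ (divr_gt0 e0 M0).
  have -> : (fun x => fr x - l x)
      = fun x => (f (k n) x - l x) - (f (k n) x - fr x).
    by apply/funext => x; ring.
  apply: (le_trans (cnormB (LB n) (L2B (Lf _) Lfr))).
  have -> : e = 2 * (e / M + `|C| * (2 * (K * (e / M) + e / M))).
    set q := e / M; transitivity (M * q); last by rewrite /M; ring.
    by rewrite mulrC divfK// gt_eqF.
  rewrite ler_wpM2l//; apply: lerD => //; apply: (le_trans (close n)).
  by rewrite ler_wpM2l// ler_wpM2l// lerD// ler_wpM2l.
have frl : fr = l %[ae mu].
  apply: filterS (cnorm_eq0_ae (L2B Lfr Ll) frl0) => x /= e xI.
  by apply/eqP; rewrite -subr_eq0 (e xI).
have L0 : L2 mu (cst 0) by apply/L2P; split; exact: sqint_cst.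
have gfr0 : gen fr (cst 0).
  apply: (generator_ae gfr L0); apply: filterS2 frE frl => x /= e1 e2 xI.
  have := e1 xI; rewrite (e2 xI) => e; apply: oppr_inj; rewrite oppr0.
  by apply: (addrI (lam * l x)); rewrite addr0.
have [c frc] := hker fr gfr0.
have lc : l = cst c %[ae mu].
  by apply: filterS2 frl frc => x /= e1 e2 xI; rewrite -(e1 xI) (e2 xI).
have s1 := sqint_cst mu (1 : R); have /L2P[slr sli] := Ll.
have mean_l (u : nat -> S -> R) (v : S -> R) : sqint mu v ->
    (forall n, sqint mu (u n)) -> (forall n, ip mu (cst 1) (u n) = 0) ->
    (forall n, nrm mu (fun x => u (k n) x - v x)
       <= cnorm mu (fun x => f (k n) x - l x)) ->
    ip mu (cst 1) v = 0.
  move=> sv su mu0 uv; apply/eqP; rewrite -normr_le0.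
  apply/ler_addgt0Pl => e e0; rewrite addr0.
  have M0 : 0 < nrm mu (cst 1) + 1 by rewrite ltr_wpDl// nrm_ge0.
  have [n [n1 _]] := approx _ (divr_gt0 e0 M0).
  have := cauchy_schwarz s1 (sqintB (su (k n)) sv).
  rewrite (ipBr s1 (su _) sv) mu0 sub0r normrN => /le_trans; apply.
  apply: (@le_trans _ _ ((nrm mu (cst 1) + 1) * (e / (nrm mu (cst 1) + 1)))).
    apply: ler_pM; rewrite ?nrm_ge0 ?lerDl//; exact: le_trans (uv n) n1.
  by rewrite mulrC divfK// gt_eqF.
have cst_mean (a : R) (v : S -> R) : sqint mu v -> ip mu (cst 1) v = 0 ->
    v = cst a %[ae mu] -> nrm mu v = 0.
  move=> sv v0 va; have sa := sqint_cst mu a.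
  have := ip_ae sv sa s1 va; rewrite v0 ip.unlock.
  under eq_Rintegral do rewrite mul1r.
  rewrite Rintegral_cst// (_ : fine _ = 1); last first.
    exact: (congr1 fine (probability_setT mu)).
  rewrite mulr1 => a0; rewrite (nrm_ae sv sa va) -a0; exact: nrm0.
have nrl : nrm mu (re_fun l) = 0.
  apply: (cst_mean (complex.Re c)) => //.
    apply: (mean_l (fun n => re_fun (f n))) => //.
    - by move=> n; have /L2P[] := Lf n.
    - by move=> n; have [_ /L20P[_ []]] := hp n.
    - by move=> n; rewrite -re_funB; exact: nrm_re_le.
  by apply: filterS lc => x /= e xI; rewrite /re_fun (e xI).
have nil : nrm mu (im_fun l) = 0.
  apply: (cst_mean (complex.Im c)) => //.
    apply: (mean_l (fun n => im_fun (f n))) => //.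
    - by move=> n; have /L2P[] := Lf n.
    - by move=> n; have [_ /L20P[_ []]] := hp n.
    - by move=> n; rewrite -im_funB; exact: nrm_im_le.
  by apply: filterS lc => x /= e xI; rewrite /im_fun (e xI).
have cl0 : cnorm mu l = 0 by rewrite /cnorm nrl nil expr0n addr0 sqrtr0.
have [n [n1 _]] := approx (1 / 4) (divr_gt0 ltr01 (ltr0n _ 4)).
have := cnormB (LB n) (L2B L0 Ll).
have -> : (fun x => f (k n) x - l x - (cst 0 x - l x)) = f (k n).
  by apply/funext => x; rewrite /=; ring.
rewrite f1; have := cnormB L0 Ll; rewrite cl0.
have -> : cnorm mu (cst 0) = 0.
  by rewrite (_ : cst 0 = of_real (fun=> 0)) ?cnorm_of_real ?nrm0.
by move: n1; move: (cnorm mu _) (cnorm mu _) => a b; lra.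
Qed.

End SpectralGap.

(** * The theorem *)
Theorem proposition6 (R : realType) (d d' : measure_display)
    (S : measurableType d) (Om : measurableType d')
    (PP : R.-pker S ~> Om) (X : R -> Om -> S) (mu : probability S R)
    (hX : is_markov_process PP X)
    (hmu : is_invariant PP X mu)
    (hP : strongly_continuous PP X mu)
    (hL : compact_resolvent PP X mu)
    (hker : kernel_only_constants PP X mu) :
  (0 < singular_value_gap PP X mu)%E /\
  forall t : R, 0 < t ->
    (Delta PP X mu t <= 2%:E / sqrte (singular_value_gap PP X mu * t%:E))%E /\
    (((3 / 2 : R)%:E * singular_value_gap PP X mu * t%:E + 3%:E)^-1
     <= ereal_sup [set Delta PP X mu s | s in `[t, (2 * t)%R] ])%E.
Proof.
have gap0 := singular_value_gap_gt0 hX hmu hL hker.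
have Pt_cont := strong_continuity hX hmu hP.
split=> // t t0; split; first exact: (Delta_le hX hmu Pt_cont gap0 t0).
exact: (Delta_ge hX hmu Pt_cont gap0 t0).
Qed.
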